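(* Let $p_1\equiv p_2\equiv 1\pmod 4$ be primes, $k=\mathbb{Q}(\sqrt{2p_1p_2},i)$, and let $\mathbb{K}$ be an unramified quadratic extension of $k$ which is abelian over $\mathbb{Q}$. Then (1) $\ker J_{\mathbb{K}}\subset Am_s(k/\mathbb{Q}(i))$; (2) $Am_s(k/\mathbb{Q}(i))\subseteq \ker J_{k^{( * )}}$.
   Context: $i=\sqrt{-1}$. $\mathbf{C}_k$ is the ideal class group of $k$. For a finite extension $L/k$, $J_L:\mathbf{C}_k\to\mathbf{C}_L$ is the homomorphism induced by extending ideals of $k$ to $L$; $\ker J_L$ is the capitulation kernel. $Am_s(k/\mathbb{Q}(i))$ denotes the subgroup of $\mathbf{C}_k$ generated by the strongly ambiguous classes of $k/\mathbb{Q}(i)$, i.e. ideal classes of $k$ containing at least one ideal invariant under the nontrivial automorphism of $k/\mathbb{Q}(i)$. $k^{( * )}$ denotes the absolute genus field of $k$ (the maximal unramified extension of $k$ that is abelian over $\mathbb{Q}$); here $k^{( * )}=\mathbb{Q}(\sqrt2,\sqrt{p_1},\sqrt{p_2},i)$, and the unramified quadratic extensions of $k$ abelian over $\mathbb{Q}$ are $k(\sqrt{p_1})$, $k(\sqrt{p_2})$, $k(\sqrt2)$. *)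

(* Defs.v *)
(* number fields are modelled as subfields of algC. *)
From HB Require Import structures.
From mathcomp Require Import all_boot all_order all_algebra all_field.
Set Implicit Arguments. Unset Strict Implicit. Unset Printing Implicit Defensive.
Import Order.TTheory GRing.Theory Num.Theory.
Local Open Scope ring_scope.

Definition subfield_closed (P : algC -> Prop) : Prop :=
  [/\ P 0, P 1, (forall x y, P x -> P y -> P (x - y)),
      (forall x y, P x -> P y -> P (x * y)) & (forall x, P x -> P x^-1)].

Definition gen_field (s : seq algC) : algC -> Prop :=
  fun x => forall P, subfield_closed P -> (forall a, a \in s -> P a) -> P x.

Definition OK (F : algC -> Prop) : algC -> Prop := fun x => F x /\ x \in Aint.

Definition ideal (F : algC -> Prop) (I : algC -> Prop) : Prop :=
  [/\ (forall x, I x -> OK F x), I 0,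
      (forall x y, I x -> I y -> I (x + y)) &
      (forall a x, OK F a -> I x -> I (a * x))].

Definition nz_ideal F I : Prop := ideal F I /\ exists x, I x /\ x != 0.

Definition ideal_gen (F : algC -> Prop) (S : algC -> Prop) : algC -> Prop :=
  fun x => forall M, ideal F M -> (forall y, S y -> M y) -> M x.

Definition ideal_mul F (I J : algC -> Prop) : algC -> Prop :=
  ideal_gen F (fun z => exists a b, [/\ I a, J b & z = a * b]).

Fixpoint ideal_prod F (n : nat) (J : nat -> algC -> Prop) : algC -> Prop :=
  match n with
  | 0 => OK F
  | m.+1 => ideal_mul F (ideal_prod F m J) (J m)
  end.

Definition principal F (I : algC -> Prop) : Prop :=
  exists a, OK F a /\ forall x, I x <-> exists y, OK F y /\ x = a * y.

Definition same_class F (I J : algC -> Prop) : Prop :=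
  exists a b, [/\ OK F a, OK F b, a != 0, b != 0 &
    forall x, (exists y, I y /\ x = a * y) <-> (exists y, J y /\ x = b * y)].

Definition ext_ideal (L : algC -> Prop) (I : algC -> Prop) := ideal_gen L I.

Definition in_capitulation_kernel (L : algC -> Prop) I := principal L (ext_ideal L I).

(* Invariance under the nontrivial automorphism of k/Q(i), k = Q(sqrt d, i):
   every automorphism of algC fixing i and sending sqrt d to -sqrt d
   (these restrict to exactly that automorphism of k) preserves J. *)
Definition sigma_invariant (d : algC) (J : algC -> Prop) : Prop :=
  forall u : {rmorphism algC -> algC}, u 'i = 'i -> u (sqrtC d) = - sqrtC d ->
    forall x, J x -> J (u x).

(* The class of I lies in Am_s(k/Q(i)) : the subgroup generated by the classes
   of sigma-invariant ideals, i.e. [I] = prod [J_j] * prod [J'_j]^-1. *)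
Definition in_Ams (d : algC) (k : algC -> Prop) (I : algC -> Prop) : Prop :=
  exists (n m : nat) (J J' : nat -> algC -> Prop),
    [/\ (forall j, (j < n)%N -> nz_ideal k (J j) /\ sigma_invariant d (J j)),
        (forall j, (j < m)%N -> nz_ideal k (J' j) /\ sigma_invariant d (J' j)) &
        same_class k (ideal_mul k I (ideal_prod k m J')) (ideal_prod k n J)].

Definition sqrtn (n : nat) : algC := sqrtC n%:R.

(* Main.v *)
Require Import Defs.
From HB Require Import structures.
From mathcomp Require Import all_boot all_order all_algebra all_field.
From mathcomp Require Import ring zify.
From Stdlib Require Import Classical.
Import Order.TTheory GRing.Theory Num.Theory.
Local Open Scope ring_scope.
Set Implicit Arguments. Unset Strict Implicit. Unset Printing Implicit Defensive.

(** Write s for the nontrivial automorphism of k / Q(i), d = 2 p1 p2. For every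
ideal I of O_k, I s(I) = (n) with n in Z[i].

(1) K = k(sqrt q) with q = p1, p2 or p1 p2, so q = 1 mod 4. Let I O_K = (alpha),
extend s to K fixing sqrt q, and let t generate Gal(K / k). Then
w = alpha s(alpha) / n is a unit of Q(i, sqrt q), whose norm to Q(i) is a power
of i; it is not i or -i because q = 1 mod 4. Hence, for c = alpha t(alpha) in k,
one of n / c, i n / c has norm 1 to Q(i), so it is a / s(a) by Hilbert 90, and
a I is invariant under s.

(2) Let J be invariant, so J^2 = (n), and let (g) be the Z[i]-ideal of traces of
elements of J. Then g lies in J and J in (g / 2d), so n = g^2 / m with m a divisor
of 4 d^2 in Z[i]. By the solvability of x^2 - p y^2 = -1 for p = 2, p1, p2, every
divisor of 4 d^2 is a unit times a square b^2 in the genus field, and J becomes (g / b). *)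

(** * Subfields of algC and their automorphisms *)

(** The obstacle in (1) is the unit w t(w) in c s(c) = w t(w) n^2: dividing c by some z n yields
    norm 1 only if w t(w) = z^2 with z in Z[i], which is possible for 1 and -1 = i^2 but not for i
    and -i. Excluding these two is where q = 1 mod 4 enters. Invariance of a I is then a computation
    in K: s(a) = a c / (z n), and s(I) extends to (n / alpha), so s(a I) extends to (a t(alpha) /
    z), which is (a alpha) because I O_K is stable under t. Since I O_K meets k in I, this descends
    to k.

    In (2) the trace ideal stands in for a factorization of J into ramified primes.

    Ideals are bare predicates. Instead of being inverted or factored, they are compared through
    integrality of quotients: x lies in (alpha) when x / alpha is an algebraic integer, and such a
    condition is checked on generators only. Invariance refers to automorphisms of algC, so those of
    k and K are first constructed there. *)

Section Subfield.
Variables (P : algC -> Prop) (Pf : Defs.subfield_closed P).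

Lemma subf0 : P 0. Proof. by case: Pf. Qed.
Lemma subf1 : P 1. Proof. by case: Pf. Qed.
Lemma subfB x y : P x -> P y -> P (x - y). Proof. by case: Pf => _ _ h _ _; apply: h. Qed.
Lemma subfM x y : P x -> P y -> P (x * y). Proof. by case: Pf => _ _ _ h _; apply: h. Qed.
Lemma subfV x : P x -> P x^-1. Proof. by case: Pf => _ _ _ _ h; apply: h. Qed.
Lemma subfN x : P x -> P (- x).
Proof. by move=> Px; rewrite -sub0r; apply: subfB => //; apply: subf0. Qed.
Lemma subfD x y : P x -> P y -> P (x + y).
Proof. by move=> Px Py; rewrite -[y]opprK; apply: subfB => //; apply: subfN. Qed.
Lemma subf_div x y : P x -> P y -> P (x / y).
Proof. by move=> Px Py; apply: subfM => //; apply: subfV. Qed.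
Lemma subfX x n : P x -> P (x ^+ n).
Proof.
move=> Px; elim: n => [|n IH]; first by rewrite expr0; apply: subf1.
by rewrite exprS; apply: subfM.
Qed.
Lemma subf_nat n : P n%:R.
Proof.
elim: n => [|n IH]; first exact: subf0.
by rewrite -addn1 natrD; apply: subfD => //; apply: subf1.
Qed.
Lemma subf_int n : P n%:~R.
Proof.
case: n => n; first by rewrite -pmulrn; apply: subf_nat.
by rewrite NegzE mulrNz; apply: subfN; rewrite -pmulrn; apply: subf_nat.
Qed.
Lemma subf_rat x : x \in Crat -> P x.
Proof.
move=> /CratP[a ->]; rewrite /ratr.
by apply: subf_div; apply: subf_int.
Qed.
Lemma subf_sum (I : Type) (r : seq I) (F : I -> algC) :
  (forall i, P (F i)) -> P (\sum_(i <- r) F i).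
Proof. by move=> PF; elim/big_rec: _ => [|i x _ Px]; [apply: subf0 | apply: subfD]. Qed.

Lemma subf_adjoin_sqrt x : P (x ^+ 2) ->
  Defs.subfield_closed (fun y => exists a b, [/\ P a, P b & y = a + b * x]).
Proof.
move=> Px2; split.
- by exists 0, 0; split; [exact: subf0 | exact: subf0 | ring].
- by exists 1, 0; split; [exact: subf1 | exact: subf0 | ring].
- move=> _ _ [a [b [Pa Pb ->]]] [c [d [Pc Pd ->]]].
  by exists (a - c), (b - d); split; [exact: subfB | exact: subfB | ring].
- move=> _ _ [a [b [Pa Pb ->]]] [c [d [Pc Pd ->]]].
  exists (a * c + b * d * x ^+ 2), (a * d + b * c).
  split; [| | ring]; apply: subfD; do ?apply: subfM => //.
move=> _ [a [b [Pa Pb ->]]].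
(* Rationalising by a - b x fails when it vanishes; then b = 0 or x = a / b already lies in P. If a
   + b x = 0, the inverse is 0 by convention. *)
have [/eqP| nz1] := eqVneq (a - b * x) 0.
  rewrite subr_eq0 => /eqP ab.
  have [b0|nzb] := eqVneq b 0.
    exists a^-1, 0; rewrite b0 !mul0r !addr0; split=> //; [exact: subfV|exact: subf0].
  exists (a + b * (a / b))^-1, 0; split; [| exact: subf0 |]; last first.
    by rewrite mul0r addr0 [in RHS]ab [b * x / b]mulrAC divff // mul1r -ab.
  by apply/subfV/subfD => //; apply: subfM => //; exact: subf_div.
have [z|nz2] := eqVneq (a + b * x) 0.
  by exists 0, 0; rewrite z invr0; split; [exact: subf0 | exact: subf0 | ring].
exists (a / (a ^+ 2 - b ^+ 2 * x ^+ 2)), (- b / (a ^+ 2 - b ^+ 2 * x ^+ 2)).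
have PN : P (a ^+ 2 - b ^+ 2 * x ^+ 2).
  by apply: subfB; rewrite ?exprMn; [exact: subfX | apply: subfM => //; exact: subfX].
split; [exact: subf_div | apply: subf_div => //; exact: subfN |].
have -> : a ^+ 2 - b ^+ 2 * x ^+ 2 = (a - b * x) * (a + b * x) by ring.
by field; rewrite ?nz1 ?nz2.
Qed.

End Subfield.

Lemma gen_field_closed s : Defs.subfield_closed (gen_field s).
Proof.
split=> [P h _|P h _|x y hx hy P h hs|x y hx hy P h hs|x hx P h hs].
- exact: subf0 h.
- exact: subf1 h.
- by apply: (subfB h); [apply: hx | apply: hy].
- by apply: (subfM h); [apply: hx | apply: hy].
- by apply: (subfV h); apply: hx.
Qed.
#[local] Hint Resolve gen_field_closed : core.
Local Notation gfc := (gen_field_closed _).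

Lemma gen_field_mem s x : x \in s -> gen_field s x.
Proof. by move=> xs P _; apply. Qed.

Lemma gen_field_sub s t x :
  (forall y, y \in s -> gen_field t y) -> gen_field s x -> gen_field t x.
Proof. by move=> h; apply. Qed.

Lemma gen_field_mono s t x : {subset s <= t} -> gen_field s x -> gen_field t x.
Proof. by move=> h; apply: gen_field_sub => y /h; apply: gen_field_mem. Qed.

Lemma gen_field_cons_sqrt x s y : gen_field s (x ^+ 2) -> gen_field (x :: s) y ->
  exists a b, [/\ gen_field s a, gen_field s b & y = a + b * x].
Proof.
move=> sx2 /(_ _ (subf_adjoin_sqrt (gen_field_closed s) sx2)); apply.
move=> z; rewrite inE => /orP[/eqP ->|zs].
  by exists 0, 1; split; [exact: subf0 | exact: subf1 | ring].
by exists z, 0; split; [exact: gen_field_mem | exact: subf0 | ring].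
Qed.

Lemma gen_field_nil x : gen_field [::] x <-> x \in Crat.
Proof.
split=> [|xQ]; last exact: subf_rat.
move=> h; apply: (h (fun x => x \in Crat)) => //.
split; rewrite ?rpred0 ?rpred1 // => y *.
- exact: rpredB.
- exact: rpredM.
- by rewrite rpredV.
Qed.

Lemma rmorph_id_gen_field (u : {rmorphism algC -> algC}) s x :
  (forall y, y \in s -> u y = y) -> gen_field s x -> u x = x.
Proof.
move=> us h; apply: (h (fun x => u x = x)) => //.
split; rewrite ?rmorph0 ?rmorph1 // => y.
- by move=> z uy uz; rewrite rmorphB uy uz.
- by move=> z uy uz; rewrite rmorphM uy uz.
- by move=> uy; rewrite fmorphV uy.
Qed.

Lemma rmorph_eq_gen_field (u v : {rmorphism algC -> algC}) s x :
  (forall y, y \in s -> u y = v y) -> gen_field s x -> u x = v x.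
Proof.
move=> us h; apply: (h (fun x => u x = v x)) => //.
split; rewrite ?rmorph0 ?rmorph1 // => y.
- by move=> z uy uz; rewrite !rmorphB uy uz.
- by move=> z uy uz; rewrite !rmorphM uy uz.
- by move=> uy; rewrite !fmorphV uy.
Qed.

Lemma rmorph_gen_field (u : {rmorphism algC -> algC}) s t x :
  (forall y, y \in s -> gen_field t (u y)) -> gen_field s x -> gen_field t (u x).
Proof.
move=> us h; apply: (h (fun x => gen_field t (u x))) => //.
split; rewrite ?rmorph0 ?rmorph1 //.
- exact: subf0.
- exact: subf1.
- by move=> y z; rewrite rmorphB; apply: subfB.
- by move=> y z; rewrite rmorphM; apply: subfM.
- by move=> y; rewrite fmorphV; apply: subfV.
Qed.

Section Embedding.
Variables (L : fieldExtType rat) (f : {rmorphism L -> algC}).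

(** Extension of automorphisms is available for abstract number fields, so this lemma and the next
    translate between [gen_field] and adjunction in such a field. *)
Lemma image_Fadjoin_seq (P : algC -> Prop) (Pf : Defs.subfield_closed P)
    (K : {subfield L}) rs :
    (forall z, z \in K -> P (f z)) -> (forall z, z \in rs -> P (f z)) ->
  forall z, z \in <<K & rs>>%VS -> P (f z).
Proof.
elim: rs K => [|x rs IH] K PK Prs z.
  by rewrite adjoin_nil subfield_closed; apply: PK.
rewrite adjoin_cons -[<<K; x>>%VS]/(<<K; x>>%AS : {vspace L}).
apply: IH => [{}z /Fadjoin_polyP[p /polyOverP Kp ->]|{}z zrs]; last first.
  by apply: Prs; rewrite inE zrs orbT.
rewrite horner_coef rmorph_sum; apply: subf_sum => // i.
rewrite rmorphM rmorphXn; apply: subfM => //; first exact: PK.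
by apply: subfX => //; apply: Prs; rewrite mem_head.
Qed.

Lemma gen_field_image (K : {subfield L}) (s : seq L) x :
  gen_field (map f s) x -> exists2 z, z \in <<K & s>>%VS & f z = x.
Proof.
have cl : Defs.subfield_closed (fun x => exists2 z, z \in <<K & s>>%VS & f z = x).
  split.
  - by exists 0; rewrite ?rmorph0 ?mem0v.
  - by exists 1; rewrite ?rmorph1 ?rpred1.
  - move=> _ _ [y Ky <-] [z Kz <-]; exists (y - z); rewrite ?rmorphB //; exact: rpredB.
  - move=> _ _ [y Ky <-] [z Kz <-]; exists (y * z); rewrite ?rmorphM //; exact: rpredM.
  - by move=> _ [y Ky <-]; exists y^-1; rewrite ?fmorphV ?rpredV.
move=> /(_ _ cl); apply=> y /mapP[z zs ->].
by exists z => //; apply: seqv_sub_adjoin.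
Qed.

End Embedding.

(** Inside a number field generated by s and x, the minimal polynomial of x over the field of s is
    X^2 - x^2. Hence x may be sent to -x over that field, and the resulting automorphism extends to
    algC. *)
Lemma exists_sqrt_aut s x : gen_field s (x ^+ 2) -> ~ gen_field s x ->
  exists u : {rmorphism algC -> algC}, (forall y, y \in s -> u y = y) /\ u x = - x.
Proof.
move=> sx2 sx.
have [L [f [[|x1 s1] // [fx1 fs1] genL]]] := num_field_exists (x :: s).
pose E := <<1 & s1>>%AS.
have x1E : x1 \notin E.
  apply/negP => /(image_Fadjoin_seq (P := gen_field s)(f:=f)) h; apply: sx.
  rewrite -fx1; apply: h => // [z /vlineP[a ->]|z zs].
    rewrite alg_num_field fmorph_rat; apply: subf_rat => //; exact: Crat_rat.
  by apply: gen_field_mem; rewrite -fs1 map_f.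
have x1sqE : x1 ^+ 2 \in E.
  move: sx2; rewrite -fs1 => /(gen_field_image 1%AS) [z zE fz].
  suff -> : x1 ^+ 2 = z by [].
  by apply: (fmorph_inj f); rewrite fz rmorphXn /= fx1.
have hom1 : kHom 1 E (\1%VF : 'End(L)) by rewrite kHom1.
pose q := 'X^2 - (x1 ^+ 2)%:P.
have qE : q \is a polyOver E by rewrite rpredB ?rpredX ?polyOverX ?polyOverC.
have sq : size q = 3%N by rewrite size_XnsubC.
have minq : minPoly E x1 = q.
  have dv : minPoly E x1 %| q.
    by rewrite minPoly_dvdp // rootE !hornerE subrr.
  apply/eqP; rewrite -eqp_monic ?monic_minPoly ?monicXnsubC //.
  rewrite -(dvdp_size_eqp dv) sq size_minPoly eqSS.
  have := dvdp_leq (monic_neq0 (monicXnsubC _ (ltn0Sn 1))) dv.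
  rewrite -/q sq size_minPoly ltnS => le2.
  have: (0 < adjoin_degree E x1)%N by [].
  move: le2 x1E; rewrite -adjoin_deg_eq1; move: (adjoin_degree E x1).
  by move=> n; move=> ? ? ?; apply/eqP; lia.
have rt : root (map_poly (\1%VF : 'End(L)) (minPoly E x1)) (- x1).
  rewrite map_poly_id ?minq => [|z _]; last by rewrite id_lfunE.
  by rewrite rootE !hornerE sqrrN subrr.
pose phi := kHomExtend E \1%VF x1 (- x1).
have phim : monoid_morphism phi.
  apply/kHom_monoid_morphism.
  have -> : {:L}%VS = <<E; x1>>%VS.
    rewrite -adjoin_rcons; apply/eqP; rewrite eqEsubv subvf -genL andbT.
    apply/(@Fadjoin_seqP _ _ 1%AS _ <<1 & rcons s1 x1>>%AS).
    by split=> [|z]; rewrite ?sub1v // -mem_rcons; apply: seqv_sub_adjoin.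
  by apply: (kHomExtendP (sub1v E) hom1).
pose phimM := GRing.isMonoidMorphism.Build _ _ phi phim.
pose phiRM : {rmorphism _ -> _} := HB.pack (fun_of_lfun phi) phimM.
have [nu Dnu] := extend_algC_subfield_aut f phiRM.
exists nu; split.
  move=> y; rewrite -fs1 => /mapP[z zs ->].
  rewrite -Dnu /= kHomExtend_id ?id_lfunE //.
  exact: seqv_sub_adjoin.
by rewrite -fx1 -Dnu /= (kHomExtend_val hom1) // rmorphN.
Qed.

(** * Gaussian integers *)

Lemma Aint_integral x : integralOver (intr : int -> algC) x <-> x \in Aint.
Proof.
split=> [[p mon_p px]|]; last first.
  rewrite unfold_in => /floorpP[p Dp]; exists p; last by rewrite -Dp root_minCpoly.
  rewrite monicE; apply/eqP/(@intr_inj algC).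
  by rewrite -lead_coef_map_inj //; [rewrite -Dp (monicP (minCpoly_monic x))|exact: intr_inj].
apply: root_monic_Aint px _ _; first exact: monic_map.
by apply/polyOverP => i; rewrite coef_map rpred_int.
Qed.

Lemma Aint_quadratic x t n : t \in Aint -> n \in Aint -> x ^+ 2 - t * x + n = 0 ->
  x \in Aint.
Proof.
move=> /Aint_integral tA /Aint_integral nA xq; apply/Aint_integral.
pose p := 'X^2 + (n%:P - t *: 'X).
have sp : (size (n%:P - t *: 'X)%R < size ('X^2 : {poly algC}))%N.
  rewrite size_polyXn (leq_ltn_trans (size_polyD _ _)) // gtn_max size_polyN.
  rewrite (leq_ltn_trans (size_polyC_leq1 _)) //=.
  by rewrite (leq_ltn_trans (size_scale_leq _ _)) // size_polyX.
apply: (@integral_root_monic _ _ _ _ p).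
- by rewrite monicE lead_coefDl // lead_coefXn.
- by rewrite rootE /p hornerD hornerXn hornerD hornerN hornerZ hornerC hornerX -xq; apply/eqP; ring.
apply/integral_poly => i; rewrite coefD coefB coefZ coefC coefX coefXn.
apply: integral_add; first exact: integral_nat.
apply: integral_sub; last by apply: integral_mul => //; exact: integral_nat.
by case: ifP => // _; exact: integral0.
Qed.

Lemma Aint_sqrt x : x ^+ 2 \in Aint -> x \in Aint.
Proof.
move=> xA; apply: (@Aint_quadratic x 0 (- x ^+ 2)); rewrite ?rpredN //.
by rewrite mul0r subr0 subrr.
Qed.

Lemma Aint_conj x : x \in Aint -> x^* \in Aint.
Proof. by rewrite (Aint_aut (Num.conj : {rmorphism algC -> algC})). Qed.

Lemma sqr_i : 'i ^+ 2 = -1 :> algC. Proof. exact: sqrCi. Qed.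

Lemma Aint_i : 'i \in Aint.
Proof. by apply: Aint_sqrt; rewrite sqr_i rpredN. Qed.

Definition Zi (x : algC) := exists a b : int, x = a%:~R + b%:~R * 'i.

Lemma mulCii : 'i * 'i = -1 :> algC. Proof. by rewrite -expr2 sqr_i. Qed.

Lemma Zi_int (n : int) : Zi n%:~R. Proof. by exists n, 0; rewrite mul0r addr0. Qed.
Lemma Zi_nat (n : nat) : Zi n%:R. Proof. exact: (Zi_int n). Qed.
Lemma Zi0 : Zi 0. Proof. exact: (Zi_int 0). Qed.
Lemma Zi1 : Zi 1. Proof. exact: (Zi_int 1). Qed.
Lemma Zi_i : Zi 'i. Proof. by exists 0, 1; rewrite mul1r add0r. Qed.
Lemma ZiN x : Zi x -> Zi (- x).
Proof. by move=> [a [b ->]]; exists (- a), (- b); rewrite !rmorphN; ring. Qed.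
Lemma ZiD x y : Zi x -> Zi y -> Zi (x + y).
Proof. by move=> [a [b ->]] [c [d ->]]; exists (a + c), (b + d); rewrite !rmorphD; ring. Qed.
Lemma ZiB x y : Zi x -> Zi y -> Zi (x - y).
Proof. by move=> zx zy; apply/ZiD/ZiN. Qed.
Lemma ZiM x y : Zi x -> Zi y -> Zi (x * y).
Proof.
move=> [a [b ->]] [c [d ->]]; exists (a * c - b * d), (a * d + b * c).
rewrite rmorphB rmorphD !rmorphM /=; ring: mulCii.
Qed.
Lemma ZiX x n : Zi x -> Zi (x ^+ n).
Proof. by move=> zx; elim: n => [|n IH]; [exact: Zi1 | rewrite exprS; apply: ZiM]. Qed.

Lemma conjC_i : 'i^* = - 'i :> algC. Proof. exact: conjCi. Qed.

Lemma Zi_conj x : Zi x -> Zi x^*.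
Proof.
move=> [a [b ->]]; exists a, (- b).
by rewrite rmorphD rmorphM /= !rmorph_int conjC_i rmorphN mulNr mulrN.
Qed.

Lemma Zi_Aint x : Zi x -> x \in Aint.
Proof. by move=> [a [b ->]]; rewrite rpredD ?rpredM ?Aint_int ?Aint_i. Qed.

Lemma Zi_gen_field x : Zi x -> gen_field [:: 'i] x.
Proof.
move=> [a [b ->]]; apply: (subfD gfc); first exact: (subf_int gfc).
by apply: (subfM gfc); [exact: (subf_int gfc) | apply: gen_field_mem; rewrite mem_head].
Qed.

Lemma Zi_norm x : Zi x -> exists n : nat, x * x^* = n%:R.
Proof.
move=> [a [b ->]]; exists (absz (a ^+ 2 + b ^+ 2)).
rewrite -[RHS]/((Posz (absz _))%:~R) gez0_abs ?addr_ge0 ?sqr_ge0 //.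
rewrite rmorphD rmorphM /= !rmorph_int conjC_i rmorphD !rmorphXn /=.
ring: mulCii.
Qed.

Lemma Qi_coord x : gen_field [:: 'i] x ->
  exists r s, [/\ r \in Crat, s \in Crat & x = r + s * 'i].
Proof.
have i2 : gen_field [::] ('i ^+ 2) by rewrite sqr_i; apply: (subfN gfc); exact: (subf1 gfc).
move=> /(gen_field_cons_sqrt i2)[a [b [/gen_field_nil aQ /gen_field_nil bQ ->]]].
by exists a, b.
Qed.

Lemma conj_Qi r s : r \in Crat -> s \in Crat -> (r + s * 'i)^* = r - s * 'i.
Proof. by move=> rQ sQ; rewrite rmorphD rmorphM /= conjC_i !conj_Crat // mulrN. Qed.

Lemma int_even_odd (a : int) : exists b, a = 2 * b \/ a = 2 * b + 1.
Proof. by exists (a %/ 2)%Z; lia. Qed.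

(** Trace and norm make the doubled coordinates a, b integers with a^2 + b^2 divisible by 4; as
    squares are 0 or 1 mod 4, both are even. *)
Lemma Zi_Qi_Aint x : gen_field [:: 'i] x -> x \in Aint -> Zi x.
Proof.
move=> /Qi_coord[r [s [rQ sQ ->]]] xA.
have /intrP[a a2r] : 2 * r \in Num.int.
  apply: Cint_rat_Aint; first by rewrite rpredM ?rpred_nat.
  have -> : 2 * r = (r + s * 'i) + (r + s * 'i)^* by rewrite conj_Qi //; ring.
  by rewrite rpredD // Aint_conj.
have /intrP[b b2s] : 2 * s \in Num.int.
  apply: Cint_rat_Aint; first by rewrite rpredM ?rpred_nat.
  have -> : 2 * s = - 'i * ((r + s * 'i) - (r + s * 'i)^*).
    rewrite conj_Qi //; ring: mulCii.
  by rewrite rpredM ?rpredB ?rpredN ?Aint_i // Aint_conj.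
have /intrP[c cN] : r ^+ 2 + s ^+ 2 \in Num.int.
  apply: Cint_rat_Aint; first by rewrite rpredD ?rpredX.
  have -> : r ^+ 2 + s ^+ 2 = (r + s * 'i) * (r + s * 'i)^*.
    rewrite conj_Qi //; ring: mulCii.
  by rewrite rpredM // Aint_conj.
have abc : a ^+ 2 + b ^+ 2 = 4 * c.
  apply/(@intr_inj algC); rewrite rmorphD !rmorphXn rmorphM /= -a2r -b2s -cN.
  by rewrite rmorph_nat; ring.
have [a' [b' [aE bE]]] : exists a' b', a = 2 * a' /\ b = 2 * b'.
  have [a' a'E] := int_even_odd a; have [b' b'E] := int_even_odd b.
  by exists a', b'; move: abc; rewrite !expr2; case: a'E b'E => -> [] -> abc; nia.
exists a', b'.
have two : 2 != 0 :> algC by rewrite pnatr_eq0.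
have -> : r = a'%:~R by apply: (mulfI two); rewrite a2r aE rmorphM.
have -> : s = b'%:~R by apply: (mulfI two); rewrite b2s bE rmorphM.
by [].
Qed.

Lemma Crat_round r : r \in Crat -> exists n : int, (r - n%:~R) ^+ 2 <= 4^-1.
Proof.
move=> rQ; have rR : r + 2^-1 \is Num.real.
  by apply: Creal_Crat; rewrite rpredD // rpredV rpred_nat.
exists (Num.floor (r + 2^-1)).
have /andP[] := real_floor_itv rR; set n := Num.floor _; rewrite rmorphD /= => h1 h2.
set t := r - _.
have tR : t \is Num.real by rewrite rpredB ?rpred_int ?Creal_Crat.
have h3 : - 2^-1 <= t by rewrite lerBrDr addrC lerBlDr.
have h4 : t <= 2^-1.
  rewrite lerBlDl ltW // -(ltrD2r 2^-1).
  by have -> : n%:~R + 2^-1 + 2^-1 = n%:~R + 1 :> algC by field.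
have -> : 4^-1 = 2^-1 ^+ 2 :> algC by rewrite exprVn -natrX.
rewrite -subr_ge0 subr_sqr mulr_ge0 ?subr_ge0 //.
by rewrite addrC -lerBlDr sub0r.
Qed.

Lemma Zi_div x y : Zi x -> Zi y -> y != 0 ->
  exists q, Zi q /\ (x - q * y) * (x - q * y)^* < y * y^*.
Proof.
move=> zx zy y0.
have : gen_field [:: 'i] (x / y) by apply: (subf_div gfc); apply: Zi_gen_field.
move=> /Qi_coord[r [s [rQ sQ xy]]].
have [[m hm] [n hn]] := (Crat_round rQ, Crat_round sQ).
exists (m%:~R + n%:~R * 'i); split; first by exists m, n.
have -> : x - (m%:~R + n%:~R * 'i) * y =
          ((r - m%:~R) + (s - n%:~R) * 'i) * y.
  by rewrite -[x](divfK y0) xy; ring.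
rewrite rmorphM mulrACA /= conj_Qi ?rpredB ?rpred_int //.
have yy : 0 < y * y^* by rewrite -normCK exprn_gt0 // normr_gt0.
rewrite -[ltRHS]mul1r ltr_pM2r //.
set e := _ - _ in hm *; set f := _ - _ in hn *.
have -> : (e + f * 'i) * (e - f * 'i) = e ^+ 2 + f ^+ 2 by ring: mulCii.
apply: le_lt_trans (lerD hm hn) _.
rewrite -[ltRHS](@mulVf _ 4) ?pnatr_eq0 // mulr_natr.
by rewrite -mulr2n ltr_pMn2l // invr_gt0 ltr0n.
Qed.

(** Descent on the norm: an element of P not divisible by the candidate g leaves a nonzero remainder
    in P of smaller norm. As P is a mere predicate, excluded middle decides whether such an element
    exists. *)
Lemma Zi_principal (P : algC -> Prop) :
    (forall x, P x -> Zi x) -> (forall x y, P x -> P y -> P (x + y)) ->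
    (forall a x, Zi a -> P x -> P (a * x)) -> (exists x, P x /\ x != 0) ->
  exists g, [/\ P g, g != 0 & forall x, P x -> exists q, Zi q /\ x = q * g].
Proof.
move=> PZ PD PM [x0 [Px0 nz0]].
have [n0 x0n] := Zi_norm (PZ _ Px0).
elim/ltn_ind: n0 x0 Px0 nz0 x0n => n IH g Pg g0 gn.
have [[y [Py yg]]|noy] := classic (exists y, P y /\ ~ exists q, Zi q /\ y = q * g).
  have [q [zq hq]] := Zi_div (PZ _ Py) (PZ _ Pg) g0.
  have Pz : P (y - q * g) by rewrite -mulNr; apply: PD => //; apply: PM => //; exact: ZiN.
  have [m zm] := Zi_norm (PZ _ Pz).
  apply: (IH m _ _ Pz) => //; first by move: hq; rewrite zm gn ltr_nat.
  by apply/eqP => /eqP; rewrite subr_eq0 => /eqP yq; apply: yg; exists q.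
exists g; split=> // x Px; apply: NNPP => h; apply: noy; by exists x.
Qed.

Lemma Zi_bezout x y : Zi x -> Zi y -> x != 0 ->
  exists g u v x' y', [/\ Zi u, Zi v, Zi x' & Zi y'] /\
    [/\ g = u * x + v * y, x = x' * g & y = y' * g].
Proof.
move=> zx zy x0.
pose P z := exists u v, [/\ Zi u, Zi v & z = u * x + v * y].
have [||||g [[u [v [zu zv gE]]] _ Pg]] := @Zi_principal P.
- by move=> _ [u [v [zu zv ->]]]; apply: ZiD; apply: ZiM.
- move=> _ _ [u [v [zu zv ->]]] [u' [v' [zu' zv' ->]]].
  by exists (u + u'), (v + v'); split; [exact: ZiD | exact: ZiD | ring].
- move=> a _ za [u [v [zu zv ->]]].
  by exists (a * u), (a * v); split; [exact: ZiM | exact: ZiM | ring].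
- by exists x; split=> //; exists 1, 0; split; [exact: Zi1 | exact: Zi0 | ring].
have [|x' [zx' xE]] := Pg x; first by exists 1, 0; split; [exact: Zi1 | exact: Zi0 | ring].
have [|y' [zy' yE]] := Pg y; first by exists 0, 1; split; [exact: Zi0 | exact: Zi1 | ring].
by exists g, u, v, x', y'.
Qed.

Lemma Zi_norm1 x : Zi x -> x * x^* = 1 -> x \in [:: 1; -1; 'i; - 'i].
Proof.
move=> [a [b ->]].
rewrite rmorphD rmorphM /= !rmorph_int conjC_i => h.
have : a ^+ 2 + b ^+ 2 = 1.
  apply/(@intr_inj algC); rewrite rmorphD !rmorphXn /= rmorph1 /= -[RHS]h; ring: mulCii.
move=> ab; have : [\/ a = 1 /\ b = 0, a = -1 /\ b = 0, a = 0 /\ b = 1 | a = 0 /\ b = -1].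
  move: ab; rewrite !expr2 => ab.
  have ha : -1 <= a /\ a <= 1 by split; nia.
  have hb : -1 <= b /\ b <= 1 by split; nia.
  have [] : a = -1 \/ a = 0 \/ a = 1 by lia.
    by move=> aE; rewrite aE in ab *; apply: Or42; split; lia.
  have [] : b = -1 \/ b = 0 \/ b = 1 by lia.
  - by move=> bE; rewrite bE in ab *; move=> [aE|aE]; rewrite aE in ab *; [apply: Or44|lia].
  - by move=> [bE|bE]; rewrite bE in ab *; move=> [aE|aE]; rewrite aE in ab *;
      [lia|apply: Or41|apply: Or43|lia].
by rewrite !inE; case=> -[-> ->];
  rewrite ?rmorphN ?rmorph1 ?rmorph0 ?mul0r ?mul1r ?mulN1r ?addr0 ?add0r ?eqxx ?orbT.
Qed.

Lemma Zi_unit x y : Zi x -> Zi y -> x * y = 1 -> x \in [:: 1; -1; 'i; - 'i].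
Proof.
move=> zx zy xy; apply: Zi_norm1 => //.
have [[m xm] [n yn]] := (Zi_norm zx, Zi_norm zy).
have : (m * n)%:R = 1 :> algC by rewrite natrM -xm -yn mulrACA -rmorphM xy rmorph1 mulr1.
by move/eqP; rewrite pnatr_eq1 muln_eq1 xm => /andP[/eqP -> _].
Qed.

(** * Units of Q(i, sqrt q) *)

Lemma sqrtn_sqr n : sqrtn n ^+ 2 = n%:R.
Proof. exact: sqrtCK. Qed.

Lemma sqrtn_ge0 n : 0 <= sqrtn n.
Proof. by rewrite sqrtC_ge0 ler0n. Qed.

Lemma sqrtn_conj n : (sqrtn n)^* = sqrtn n.
Proof. exact: geC0_conj (sqrtn_ge0 n). Qed.

Lemma sqrtnM m n : sqrtn (m * n) = sqrtn m * sqrtn n.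
Proof. by rewrite /sqrtn natrM sqrtCM ?nnegrE ?ler0n. Qed.

Lemma Aint_sqrtn n : sqrtn n \in Aint.
Proof. by apply: Aint_sqrt; rewrite sqrtn_sqr (Aint_int n). Qed.

Lemma Qi_real_Crat x : gen_field [:: 'i] x -> x^* = x -> x \in Crat.
Proof.
move=> /Qi_coord[r [s [rQ sQ ->]]]; rewrite conj_Qi // => /eqP.
rewrite -subr_eq0 => /eqP h; have : s * 'i = 0.
  by apply: (@mulfI _ 2); rewrite ?pnatr_eq0 // mulr0 -oppr0 -h; ring.
by move=> ->; rewrite addr0.
Qed.

Lemma Crat_sqr_nat x n : x \in Crat -> x ^+ 2 = n%:R -> exists m, n = (m ^ 2)%N.
Proof.
move=> xQ xn.
have /intrP[a xa] : x \in Num.int.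
  by apply: Cint_rat_Aint => //; apply: Aint_sqrt; rewrite xn (Aint_int n).
exists (absz a); apply/eqP; rewrite -(eqr_nat algC) -xn xa natrX natr_absz.
rewrite -!rmorphXn /= eqr_int. apply/eqP; nia.
Qed.

Lemma sqrtn_Qi n : gen_field [:: 'i] (sqrtn n) -> exists m, n = (m ^ 2)%N.
Proof.
move=> h; apply: Crat_sqr_nat (sqrtn_sqr n).
by apply: Qi_real_Crat h (sqrtn_conj n).
Qed.

(** Write sqrt b = x + y sqrt a over Q(i). If x y is nonzero, squaring puts sqrt a, hence sqrt b, in
    Q(i); if x = 0, then sqrt (a b) = a y does lie there. *)
Lemma sqrtn_Qi_sqrtn a b : (0 < a)%N -> gen_field [:: sqrtn a; 'i] (sqrtn b) ->
  (exists m, b = (m ^ 2)%N) \/ (exists m, (a * b)%N = (m ^ 2)%N).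
Proof.
move=> a0.
have sa : gen_field [:: 'i] (sqrtn a ^+ 2) by rewrite sqrtn_sqr; exact: (subf_nat gfc).
move=> /(gen_field_cons_sqrt sa)[x [y [xQ yQ e]]].
have [x0|x0] := eqVneq x 0.
  right; apply: sqrtn_Qi; rewrite sqrtnM e x0 add0r mulrCA -expr2.
  exact: (subfM gfc).
left; apply: sqrtn_Qi.
have [y0|y0] := eqVneq y 0; first by rewrite e y0 mul0r addr0.
suff saQ : gen_field [:: 'i] (sqrtn a) by rewrite e; apply: (subfD gfc) => //; apply: (subfM gfc).
have -> : sqrtn a = (sqrtn b ^+ 2 - x ^+ 2 - y ^+ 2 * sqrtn a ^+ 2) / (2 * x * y).
  by rewrite [sqrtn b]e; field; rewrite ?x0 ?y0.
rewrite sqrtn_sqr; apply: (subf_div gfc).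
  apply: (subfB gfc); first by apply: (subfB gfc); [exact: (subf_nat gfc)|exact: (subfX gfc _)].
  by apply: (subfM gfc) => //; apply: (subfX gfc _).
by apply: (subfM gfc) => //; apply: (subfM gfc) => //; exact: (subf_nat gfc).
Qed.

Lemma odd_logn_not_square p n m : odd (logn p n) -> n <> (m ^ 2)%N.
Proof. by move=> o e; move: o; rewrite e lognX mul2n odd_double. Qed.

(** Arithmetic core of the exclusion of i. For r = x + y sqrt q of norm e / 2, M is the trace of 2
    r^2, X = 4 x and Y = 4 q y. Both X and Y are even, and halving them leaves Y1^2 = q (X1^2 - 2
    e), so Y1^2 = X1^2 + 2 mod 4, which no two squares satisfy. *)
Lemma no_half_norm (k e M X Y : int) : e * e = 1 -> X * X = 2 * M + 4 * e ->
  Y * Y = (4 * k + 1) * (2 * M - 4 * e) -> False.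
Proof.
move=> e2 eX eY.
have [X1 [XE|XE]] := int_even_odd X; have [Y1 [YE|YE]] := int_even_odd Y;
  rewrite XE in eX; rewrite YE in eY; try lia.
have e1 : e = 1 \/ e = -1 by nia.
have MX : M = 2 * (X1 * X1) - 2 * e by lia.
have eY1 : Y1 * Y1 = (4 * k + 1) * (X1 * X1 - 2 * e) by rewrite MX in eY; lia.
have [X2 X2E] := int_even_odd X1; have [Y2 Y2E] := int_even_odd Y1.
by clear - eY1 e1 X2E Y2E; case: X2E => X2E; case: Y2E => Y2E;
  rewrite X2E Y2E in eY1; case: e1 => e1; rewrite e1 in eY1; lia.
Qed.

Section RelativeNorm.

Variables (q : nat) (tau : {rmorphism algC -> algC}).
Hypotheses (q4 : (q %% 4 = 1)%N).
Variable p : nat.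
Hypotheses (p_gt4 : (4 < p)%N) (odd_pq : odd (logn p q)).
Hypotheses (tau_i : tau 'i = 'i) (tau_q : tau (sqrtn q) = - sqrtn q).

Let s := sqrtn q.
Let F := gen_field [:: s; 'i].
Let Qi := gen_field [:: 'i].

Lemma F_coord x : F x -> exists a b, [/\ Qi a, Qi b & x = a + b * s].
Proof. by apply: gen_field_cons_sqrt; rewrite sqrtn_sqr; exact: (subf_nat gfc). Qed.

Lemma tau_Qi x : Qi x -> tau x = x.
Proof. by apply: rmorph_id_gen_field => y; rewrite inE => /eqP ->. Qed.

Lemma conj_Qi_closed x : Qi x -> Qi x^*.
Proof.
apply: (@rmorph_gen_field (Num.conj : {rmorphism algC -> algC})) => y.
rewrite inE => /eqP ->; rewrite /= conjC_i.
by apply: (subfN gfc); apply: gen_field_mem; rewrite mem_head.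
Qed.

Lemma s_notin_Qi : ~ Qi s.
Proof. by move=> /sqrtn_Qi[m]; apply: odd_logn_not_square odd_pq. Qed.

Lemma F_conj x : F x -> F x^*.
Proof.
apply: (@rmorph_gen_field (Num.conj : {rmorphism algC -> algC})) => y.
rewrite !inE => /orP[] /eqP ->.
  by rewrite /= sqrtn_conj; apply: gen_field_mem; rewrite mem_head.
rewrite /= conjC_i.
by apply: (subfN gfc); apply: gen_field_mem; rewrite !inE eqxx orbT.
Qed.

Lemma tau_conj x : F x -> tau x^* = (tau x)^*.
Proof.
move=> /F_coord[a [b [aQ bQ ->]]].
rewrite !rmorphD !rmorphM /= sqrtn_conj tau_q !tau_Qi //; try exact: conj_Qi_closed.
by rewrite rmorphN /= sqrtn_conj.
Qed.

(** If b were not real, comparing x with its conjugate would express s over Q(i). *)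
Lemma F_real_coord x : F x -> x^* = x ->
  exists a b, [/\ a \in Crat, b \in Crat & x = a + b * s].
Proof.
move=> /F_coord[a [b [aQ bQ ->]]]; rewrite rmorphD rmorphM /= sqrtn_conj => h.
have aQ' := conj_Qi_closed aQ; have bQ' := conj_Qi_closed bQ.
have bb : b^* = b.
  apply/eqP; case: (eqVneq b^* b) => // nb; case: s_notin_Qi.
  have -> : s = (a - a^*) / (b^* - b).
    apply: (@mulIf _ (b^* - b)); rewrite ?subr_eq0 // divfK ?subr_eq0 //.
    apply/eqP; rewrite -subr_eq0.
    have -> : s * (b^* - b) - (a - a^*) = (a^* + b^* * s) - (a + b * s) by ring.
    by rewrite h subrr.
  by apply: (subf_div gfc); apply: (subfB gfc).
exists a, b; split; [| exact: Qi_real_Crat | by []].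
by apply: Qi_real_Crat => //; apply: (addIr (b * s)); rewrite -[in LHS]bb.
Qed.

Lemma s_sqr : s ^+ 2 = q%:R. Proof. exact: sqrtn_sqr. Qed.

(* T = w / w^* + w^* / w is real, tau T = - T and |T| <= 2, so T^2 / q is a
   rational square with T^2 an integer at most 4 < p, whence T = 0 and
   w = +-i w^*. Then r = w / (1 +- i) lies in Q(sqrt q) and has norm +-1/2 while
   2 r^2 = w w^* is integral: this is impossible modulo 4. *)
Lemma unit_norm_neq_i w : F w -> w \in Aint -> w^-1 \in Aint -> w * tau w = 'i -> False.
Proof.
move=> wF wA wiA wn.
have i0 : 'i != 0 :> algC by exact: neq0Ci.
have w0 : w != 0 by apply/eqP => w0; move: wn i0; rewrite w0 mul0r => <-; rewrite eqxx.
set w' := w^*.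
have w'0 : w' != 0 by rewrite /w' conjC_eq0.
have w'F : F w' by exact: F_conj.
have w'A : w' \in Aint by exact: Aint_conj.
have w'iA : w'^-1 \in Aint by rewrite /w' -fmorphV; exact: Aint_conj.
have tw : tau w = 'i / w by rewrite -wn [w * _]mulrC mulfK.
have tw' : tau w' = - 'i / w' by rewrite tau_conj // tw rmorphM fmorphV /= conjC_i.
pose T := w / w' + w' / w.
have TF : F T by apply: (subfD gfc); apply: (subf_div gfc).
have TA : T \in Aint by rewrite rpredD ?rpredM.
have tT : tau T = - T.
  by rewrite /T rmorphD !fmorph_div tw tw'; field; rewrite ?i0 ?w0 ?w'0.
have Tr : T^* = T.
  by rewrite /T rmorphD !fmorph_div /= /w' conjCK addrC.
have [a [b [aQ bQ Tab]]] := F_real_coord TF Tr.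
have ratQi x : x \in Crat -> Qi x by exact: (subf_rat gfc).
have a0 : a = 0.
  apply: (@mulfI _ 2); rewrite ?pnatr_eq0 // mulr0.
  have -> : 2 * a = T + tau T.
    rewrite Tab rmorphD rmorphM tau_q !tau_Qi; try exact: ratQi.
    by rewrite /s; ring.
  by rewrite tT subrr.
have T2 : T ^+ 2 = b ^+ 2 * q%:R by rewrite Tab a0 add0r exprMn s_sqr.
have [n Tn] : exists n : nat, T ^+ 2 = n%:R.
  have /intrP[m Tm] : T ^+ 2 \in Num.int.
    by apply: Cint_rat_Aint; [rewrite T2 rpredM ?rpredX ?rpred_nat | rewrite rpredX].
  have : 0 <= T ^+ 2 by rewrite real_exprn_even_ge0 //; apply/CrealP.
  by rewrite Tm ler0z; case: m Tm => // n Tm _; exists n.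
have n4 : (n <= 4)%N.
  rewrite -(ler_nat algC) -Tn -[T ^+ 2]ger0_norm ?real_exprn_even_ge0 //; last by apply/CrealP.
  rewrite normrX.
  have -> : 4%:R = 2 ^+ 2 :> algC by rewrite -natrX.
  rewrite lerXn2r ?nnegrE ?normr_ge0 //.
  apply: le_trans (ler_normD _ _) _.
  by rewrite !normf_div norm_conjC divff ?normr_eq0.
have n0 : n = 0%N.
  apply/eqP; case: (posnP n) => // n_gt0; exfalso.
  have [m nqm] : exists m, (n * q)%N = (m ^ 2)%N.
    apply: (@Crat_sqr_nat (b * q%:R)); first by rewrite rpredM ?rpred_nat.
    by rewrite natrM -Tn T2; ring.
  (* As 0 < n <= 4 < p, the odd valuation of q at p is also that of n q. *)
  apply: (@odd_logn_not_square p _ m _ nqm); have q_gt0 : (0 < q)%N by case: (q) q4.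
  rewrite lognM // (_ : logn p n = 0)%N //; apply/eqP; rewrite -leqn0 leqNgt logn_gt0.
    apply/negP; rewrite mem_primes => /and3P[_ _ /dvdn_leq]; lia.
have T0 : T = 0 by apply/eqP; rewrite -sqrf_eq0 Tn n0.
have [e [e2 we]] : exists e : int, e ^+ 2 = 1 /\ w = e%:~R * 'i * w'.
  have : (w - 'i * w') * (w + 'i * w') = 0.
    have -> : (w - 'i * w') * (w + 'i * w') = T * (w * w').
      rewrite /T [RHS]mulrDl; have -> : w / w' * (w * w') = w ^+ 2 by field; rewrite ?w'0.
      have -> : w' / w * (w * w') = w' ^+ 2 by field; rewrite ?w0.
      ring: mulCii.
    by rewrite T0 mul0r.
  move/eqP; rewrite mulf_eq0 subr_eq0 addr_eq0 => /orP[] /eqP wE.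
    by exists 1; rewrite mul1r.
  by exists (-1); rewrite mulN1r mulNr.
have ee : e%:~R ^+ 2 = 1 :> algC by rewrite -rmorphXn e2.
have nz k : k ^+ 2 = 1 -> 1 + k * 'i != 0 :> algC.
  move=> k2; apply/eqP => h; have : (1 + k * 'i) * (1 - k * 'i) = 2.
    by rewrite -[2]/(1 + 1) -[in RHS]k2; ring: mulCii k2.
  by rewrite h mul0r => /eqP; rewrite eq_sym pnatr_eq0.
have ne1 := nz _ ee.
have ne2 : 1 - e%:~R * 'i != 0 :> algC by rewrite -mulNr; apply: nz; rewrite sqrrN.
pose r := w / (1 + e%:~R * 'i).
have iF : F 'i by apply: gen_field_mem; rewrite !inE eqxx orbT.
have rF : F r.
  apply: (subf_div gfc) => //; apply: (subfD gfc); first exact: (subf1 gfc).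
  by apply: (subfM gfc) => //; exact: (subf_int gfc).
have rw' : r = w' / (1 - e%:~R * 'i).
  rewrite /r we; apply/eqP; rewrite eqr_div //; apply/eqP.
  rewrite -[e%:~R]/e%:~R; ring: mulCii ee.
have rr : r^* = r.
  rewrite [RHS]rw' /r fmorph_div rmorphD rmorphM /= rmorph1 rmorph_int conjC_i.
  by rewrite mulrN.
have [x [y [xQ yQ rxy]]] := F_real_coord rF rr.
have tr : tau r = x - y * s.
  by rewrite rxy rmorphD rmorphM tau_q !tau_Qi ?mulrN; try exact: ratQi.
have rn : x ^+ 2 - q%:R * y ^+ 2 = e%:~R / 2.
  have -> : x ^+ 2 - q%:R * y ^+ 2 = r * tau r by rewrite tr rxy -s_sqr; ring.
  have te : tau (1 + e%:~R * 'i) = 1 + e%:~R * 'i.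
    by rewrite rmorphD rmorphM rmorph1 rmorph_int tau_i.
  rewrite /r fmorph_div te mulf_div wn.
  apply/eqP; rewrite eqr_div ?mulf_neq0 ?pnatr_eq0 //; apply/eqP; ring: mulCii ee.
have ww : 2 * r ^+ 2 \in Aint.
  have -> : 2 * r ^+ 2 = w * w'; last by rewrite rpredM.
  have -> : r ^+ 2 = w / (1 + e%:~R * 'i) * (w' / (1 - e%:~R * 'i)) by rewrite -rw' -/r.
  have -> : 2 = (1 + e%:~R * 'i) * (1 - e%:~R * 'i) :> algC by ring: mulCii ee.
  by field; rewrite ?ne1 ?ne2.
have [M hM] : exists M : int, 4 * (x ^+ 2 + q%:R * y ^+ 2) = M%:~R.
  apply/intrP; apply: Cint_rat_Aint.
    by rewrite rpredM ?rpredD ?rpredM ?rpredX ?rpred_nat.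
  have -> : 4 * (x ^+ 2 + q%:R * y ^+ 2) = 2 * r ^+ 2 + tau (2 * r ^+ 2).
    by rewrite rmorphM rmorphXn rmorph_nat tr rxy -s_sqr; ring.
  by rewrite rpredD // Aint_aut.
have [X hX] : exists X : int, 4 * x = X%:~R.
  apply/intrP; apply: Cint_rat_Aint; first by rewrite rpredM ?rpred_nat.
  apply: Aint_sqrt; have -> : (4 * x) ^+ 2 = (2 * M + 4 * e)%:~R.
    rewrite rmorphD !rmorphM /= -hM -[e%:~R](@divfK _ 2) ?pnatr_eq0 // -rn; ring.
  exact: Aint_int.
have [Y hY] : exists Y : int, 4 * q%:R * y = Y%:~R.
  apply/intrP; apply: Cint_rat_Aint; first by rewrite rpredM ?rpredM ?rpred_nat.
  apply: Aint_sqrt; have -> : (4 * q%:R * y) ^+ 2 = (q%:Z * (2 * M - 4 * e))%:~R.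
    rewrite rmorphM rmorphB !rmorphM /= -hM -[e%:~R](@divfK _ 2) ?pnatr_eq0 // -rn.
    rewrite -[(Posz q)%:~R]/(q%:R); ring.
  exact: Aint_int.
have eX : X ^+ 2 = 2 * M + 4 * e.
  apply/(@intr_inj algC); rewrite rmorphXn /= -hX rmorphD !rmorphM /= -hM.
  rewrite -[e%:~R](@divfK _ 2) ?pnatr_eq0 // -rn; ring.
have eY : Y ^+ 2 = q%:Z * (2 * M - 4 * e).
  apply/(@intr_inj algC); rewrite rmorphXn /= -hY rmorphM rmorphB !rmorphM /= -hM.
  rewrite -[e%:~R](@divfK _ 2) ?pnatr_eq0 // -rn -[(Posz q)%:~R]/(q%:R); ring.
have [k qk] : exists k : int, q%:Z = 4 * k + 1.
  by exists (q %/ 4)%N; move: (divn_eq q 4); rewrite q4; move: (q %/ 4)%N => k; clear; lia.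
move: eX eY e2; rewrite qk !expr2 => eX eY e2.
exact: no_half_norm e2 eX eY.
Qed.

Lemma unit_norm_sign w : F w -> w != 0 -> w \in Aint -> w^-1 \in Aint ->
  w * tau w = 1 \/ w * tau w = -1.
Proof.
move=> wF w0 wA wiA.
have nQ x : F x -> Qi (x * tau x).
  move=> /F_coord[a [b [aQ bQ ->]]].
  rewrite rmorphD rmorphM tau_q !tau_Qi //.
  have -> : (a + b * s) * (a + b * - sqrtn q) = a ^+ 2 - b ^+ 2 * s ^+ 2 by rewrite -/s; ring.
  rewrite s_sqr; apply: (subfB gfc); first exact: (subfX gfc _).
  by apply: (subfM gfc); [exact: (subfX gfc _) | exact: (subf_nat gfc)].
have zx : Zi (w * tau w) by apply: Zi_Qi_Aint; [exact: nQ | rewrite rpredM ?Aint_aut].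
have zy : Zi (w^-1 * tau w^-1).
  by apply: Zi_Qi_Aint; [apply: nQ; exact: (subfV gfc) | rewrite rpredM ?Aint_aut].

have : (w * tau w) * (w^-1 * tau w^-1) = 1.
  by rewrite mulrACA -rmorphM divff // rmorph1 mulr1.
move=> /(Zi_unit zx zy); rewrite !inE => /or4P[] /eqP h; [by left | by right | |].
  by case: (unit_norm_neq_i wF wA wiA h).
have iF : F 'i by apply: gen_field_mem; rewrite !inE eqxx orbT.
(* The value -i reduces to the value i: tau fixes i, so i w has relative norm i^2 (-i) = i. *)
case: (@unit_norm_neq_i ('i * w)).
- exact: (subfM gfc).
- by rewrite rpredM ?Aint_i.
- by rewrite invfM rpredM // invCi rpredN Aint_i.
by rewrite rmorphM tau_i mulrACA mulCii h mulN1r opprK.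
Qed.

End RelativeNorm.

(** * Ideals of a quadratic extension of Q(i) *)

Section Ideals.
Variables (F : algC -> Prop) (Ff : Defs.subfield_closed F).

Lemma OK1 : OK F 1. Proof. by split; [exact: subf1 | exact: Aint1]. Qed.
Lemma OK0 : OK F 0. Proof. by split; [exact: subf0 | exact: Aint0]. Qed.
Lemma OKD x y : OK F x -> OK F y -> OK F (x + y).
Proof. by move=> [Fx Ax] [Fy Ay]; split; [exact: subfD | rewrite rpredD]. Qed.
Lemma OKM x y : OK F x -> OK F y -> OK F (x * y).
Proof. by move=> [Fx Ax] [Fy Ay]; split; [exact: subfM | rewrite rpredM]. Qed.

Lemma ideal_OK : ideal F (OK F).
Proof. by split=> //; [exact: OK0 | exact: OKD | exact: OKM]. Qed.

(** Serves as the test ideal in [ideal_mul_ind]: divisibility by c of a whole product ideal then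
    reduces to products of one element from each factor. *)
Lemma ideal_Aint_div c (P : algC -> Prop) : (forall x, P x -> OK F x) ->
  ideal F P -> ideal F (fun x => P x /\ x / c \in Aint).
Proof.
move=> PO [_ P0 PD PM]; split=> [x []||x y [Px xA] [Py yA]|a x [Fa Aa] [Px xA]].
- by move=> /PO.
- by split=> //; rewrite mul0r.
- by split; [exact: PD | rewrite mulrDl rpredD].
- by split; [exact: PM | rewrite -mulrA rpredM].
Qed.

Lemma ideal_gen_ideal S : (forall x, S x -> OK F x) -> ideal F (ideal_gen F S).
Proof.
move=> SO; split=> [x /(_ _ ideal_OK)|M [] //|x y hx hy M iM MS|a x Fa hx M iM MS].
- exact.
- by case: (iM) => _ _ MD _; apply: MD; [exact: hx | exact: hy].
- by case: (iM) => _ _ _ MM; apply: MM => //; exact: hx.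
Qed.

Lemma ideal_mul_ideal I J : (forall x, I x -> OK F x) -> (forall x, J x -> OK F x) ->
  ideal F (ideal_mul F I J).
Proof.
by move=> IO JO; apply: ideal_gen_ideal => _ [a [b [/IO Fa /JO Fb ->]]]; exact: OKM.
Qed.

Lemma mem_ideal_gen S x : S x -> ideal_gen F S x.
Proof. by move=> Sx M _; apply. Qed.

Lemma mem_ideal_mul I J a b : I a -> J b -> ideal_mul F I J (a * b).
Proof. by move=> Ia Jb; apply: mem_ideal_gen; exists a, b. Qed.

Lemma ideal_mul_ind M I J x : ideal F M -> (forall a b, I a -> J b -> M (a * b)) ->
  ideal_mul F I J x -> M x.
Proof. by move=> iM h; apply=> // _ [a [b [Ia Jb ->]]]; exact: h. Qed.

End Ideals.

Lemma rmorph_Aint (u : {rmorphism algC -> algC}) x : x \in Aint -> u x \in Aint.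
Proof. by rewrite Aint_aut. Qed.

Section QuadraticOverQi.
Variables (r : algC) (sigma : {rmorphism algC -> algC}).
Hypotheses (r2 : gen_field [:: 'i] (r ^+ 2)) (r2A : r ^+ 2 \in Aint).
Hypotheses (sigma_i : sigma 'i = 'i) (sigma_r : sigma r = - r).

Let k := gen_field [:: r; 'i].
Let Qi := gen_field [:: 'i].

Lemma quad_coord x : k x -> exists a b, [/\ Qi a, Qi b & x = a + b * r].
Proof. exact: gen_field_cons_sqrt. Qed.

Lemma Qi_sub_quad x : Qi x -> k x.
Proof. by apply: gen_field_mono => y; rewrite !inE => ->; rewrite orbT. Qed.

Lemma mem_quad_r : k r. Proof. by apply: gen_field_mem; rewrite mem_head. Qed.

Lemma OK_quad_r : OK k r.
Proof. by split; [exact: mem_quad_r | exact: Aint_sqrt]. Qed.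

Lemma sigma_Qi x : Qi x -> sigma x = x.
Proof. by apply: rmorph_id_gen_field => y; rewrite inE => /eqP ->. Qed.

Lemma sigma_quad x : k x -> k (sigma x).
Proof.
apply: rmorph_gen_field => y; rewrite !inE => /orP[] /eqP ->.
  by rewrite sigma_r; apply: (subfN gfc); exact: mem_quad_r.
by rewrite sigma_i; apply: gen_field_mem; rewrite !inE eqxx orbT.
Qed.

Lemma OK_sigma x : OK k x -> OK k (sigma x).
Proof. by move=> [kx Ax]; split; [exact: sigma_quad | exact: rmorph_Aint]. Qed.

Lemma OK_Zi x : Zi x -> OK k x.
Proof. by move=> zx; split; [apply: Qi_sub_quad; exact: Zi_gen_field | exact: Zi_Aint]. Qed.

Lemma sigma_Zi x : Zi x -> sigma x = x.
Proof. by move=> /Zi_gen_field /sigma_Qi. Qed.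

Lemma quad_trace x : k x -> Qi (x + sigma x).
Proof.
move=> /quad_coord[a [b [aQ bQ ->]]].
rewrite rmorphD rmorphM sigma_r !sigma_Qi //.
have -> : a + b * r + (a + b * - r) = a + a by ring.
exact: (subfD gfc).
Qed.

Lemma quad_norm x : k x -> Qi (x * sigma x).
Proof.
move=> /quad_coord[a [b [aQ bQ ->]]].
rewrite rmorphD rmorphM sigma_r !sigma_Qi //.
have -> : (a + b * r) * (a + b * - r) = a ^+ 2 - b ^+ 2 * r ^+ 2 by ring.
apply: (subfB gfc); first exact: (subfX gfc _).
by apply: (subfM gfc) => //; apply: (subfX gfc _).
Qed.

Lemma sigmaK_quad x : k x -> sigma (sigma x) = x.
Proof.
move=> /quad_coord[a [b [aQ bQ ->]]].
by rewrite !rmorphD !rmorphM sigma_r rmorphN sigma_r opprK !(sigma_Qi aQ, sigma_Qi bQ).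
Qed.

Lemma Zi_quad_trace x : OK k x -> Zi (x + sigma x).
Proof.
by move=> [kx Ax]; apply: Zi_Qi_Aint; [exact: quad_trace | rewrite rpredD ?rmorph_Aint].
Qed.

Lemma Zi_quad_norm x : OK k x -> Zi (x * sigma x).
Proof.
by move=> [kx Ax]; apply: Zi_Qi_Aint; [exact: quad_norm | rewrite rpredM ?rmorph_Aint].
Qed.

(* The content argument: the cross terms x s(y) are divisible by the generator
   n of (I s(I)) /\ Z[i] because x s(y) / n is a root of the monic polynomial
   T^2 - (Tr (x s(y)) / n) T + N(x) N(y) / n^2 over Z[i]. *)
Lemma ideal_norm_generator I : nz_ideal k I ->
  exists n, [/\ Zi n, n != 0, ideal_mul k I (fun z => exists y, I y /\ z = sigma y) n
    & forall x y, I x -> I y -> x * sigma y / n \in Aint].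
Proof.
pose sI z := exists y, I y /\ z = sigma y; rewrite -/sI => -[iI [x0 [Ix0 x00]]].
have [IO I0 ID IM] := iI.
have sIO z : sI z -> OK k z by rewrite /sI => -[y [Iy ->]]; apply: OK_sigma; exact: IO.
have iN := ideal_mul_ideal gfc IO sIO; have [NO N0 ND NM] := iN.
have mN x y : I x -> I y -> ideal_mul k I sI (x * sigma y).
  by move=> Ix Iy; apply: mem_ideal_mul => //; exists y.
pose P z := Zi z /\ ideal_mul k I sI z.
have Pnorm x : I x -> P (x * sigma x).
  by move=> Ix; split; [apply: Zi_quad_norm; exact: IO | exact: mN].
have [||||n [[zn In] n0 nP]] := @Zi_principal P.
- by move=> x [].
- by move=> x y [zx Nx] [zy Ny]; split; [exact: ZiD | exact: ND].
- by move=> a x za [zx Nx]; split; [exact: ZiM | apply: NM => //; exact: OK_Zi].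
- by exists (x0 * sigma x0); split; [exact: Pnorm | rewrite mulf_neq0 ?fmorph_eq0].
exists n; split=> // x y Ix Iy.
have [|t [zt tE]] := nP (x * sigma y + y * sigma x).
  split; last by apply: ND; apply: mN.
  have -> : y * sigma x = sigma (x * sigma y).
    by rewrite rmorphM sigmaK_quad 1?mulrC //; case: (IO _ Iy).
  by apply: Zi_quad_trace; apply: (OKM gfc); [exact: IO | apply: OK_sigma; exact: IO].
have [qx [zqx qxE]] := nP _ (Pnorm _ Ix); have [qy [zqy qyE]] := nP _ (Pnorm _ Iy).
apply: (@Aint_quadratic _ t (qx * qy)); rewrite ?rpredM ?Zi_Aint //.
have -> : t = (x * sigma y + y * sigma x) / n by rewrite tE mulfK.
have -> : qx = x * sigma x / n by rewrite qxE mulfK.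
have -> : qy = y * sigma y / n by rewrite qyE mulfK.
by field; rewrite ?n0.
Qed.

End QuadraticOverQi.

(** * Classes capitulating in k(sqrt q) *)

Lemma ideal_mulr1 F I x : Defs.subfield_closed F -> ideal F I ->
  ideal_mul F I (OK F) x <-> I x.
Proof.
move=> Ff iI; split=> [|Ix].
  apply: ideal_mul_ind => // a b Ia Fb; rewrite mulrC.
  by case: iI => _ _ _; apply.
by rewrite -[x]mulr1; apply: mem_ideal_mul => //; exact: OK1.
Qed.

Lemma ideal_mul1r F I x : Defs.subfield_closed F -> ideal F I ->
  ideal_mul F (OK F) I x <-> I x.
Proof.
move=> Ff iI; split=> [|Ix].
  by apply: ideal_mul_ind => // a b Fa Ib; case: iI => _ _ _; apply.
by rewrite -[x]mul1r; apply: mem_ideal_mul => //; exact: OK1.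
Qed.

(** Bounds the generator alpha of I O_K, or a conjugate of it, by testing elements of I only. It is
    used with u the identity, sigma and tau. *)
Lemma ext_ideal_semilinear K I (u : {rmorphism algC -> algC}) c x :
    Defs.subfield_closed K -> (forall y, I y -> OK K y) ->
  (forall y, I y -> c * u y \in Aint) -> ext_ideal K I x -> c * u x \in Aint.
Proof.
move=> Kf IO h /(_ (fun z => OK K z /\ c * u z \in Aint)) [||//].
  split=> [z []//||y z [Ky Ay] [Kz Az]|a z Ka [Kz Az]].
  - by split; [exact: OK0 | rewrite rmorph0 mulr0].
  - by split; [exact: OKD | rewrite rmorphD mulrDr rpredD].
  - split; first exact: OKM.
    by rewrite rmorphM mulrCA rpredM // rmorph_Aint //; case: Ka.
by move=> y Iy; split; [exact: IO | exact: h].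
Qed.

Section CapitulationKernel.

Variables (d q p : nat) (K : algC -> Prop).
Let r := sqrtn d.
Let s := sqrtn q.
Let k := gen_field [:: r; 'i].
Let F := gen_field [:: s; 'i].
Hypotheses (q4 : (q %% 4 = 1)%N) (p_gt4 : (4 < p)%N) (odd_pq : odd (logn p q)).
Hypothesis Kf : Defs.subfield_closed K.
Hypothesis KE : forall x, K x <-> gen_field [:: r; s; 'i] x.
Variables sigma tau : {rmorphism algC -> algC}.
Hypotheses (sigma_i : sigma 'i = 'i) (sigma_s : sigma s = s) (sigma_r : sigma r = - r).
Hypotheses (tau_i : tau 'i = 'i) (tau_r : tau r = r) (tau_s : tau s = - s).

Lemma sqrtn_sqr_gen n t : gen_field t (sqrtn n ^+ 2).
Proof. by rewrite sqrtn_sqr; exact: (subf_nat gfc). Qed.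

Lemma sqrtn_sqr_Aint n : sqrtn n ^+ 2 \in Aint.
Proof. by rewrite sqrtn_sqr (Aint_int n). Qed.

Lemma quad_sub_K x : k x -> K x.
Proof. by rewrite KE; apply: gen_field_mono => y; rewrite !inE => /orP[]->; rewrite ?orbT. Qed.

Lemma K_coord_r x : K x -> exists a b, [/\ F a, F b & x = a + b * r].
Proof. by rewrite KE; apply: gen_field_cons_sqrt; exact: sqrtn_sqr_gen. Qed.

Lemma K_coord_s x : K x -> exists a b, [/\ k a, k b & x = a + b * s].
Proof.
rewrite KE => h; apply: gen_field_cons_sqrt; first exact: sqrtn_sqr_gen.
by apply: gen_field_mono h => y; rewrite !inE; case/or3P=> ->; rewrite ?orbT.
Qed.

Lemma sigma_F x : F x -> sigma x = x.
Proof. by apply: rmorph_id_gen_field => y; rewrite !inE => /orP[] /eqP ->. Qed.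

Lemma tau_k x : k x -> tau x = x.
Proof. by apply: rmorph_id_gen_field => y; rewrite !inE => /orP[] /eqP ->. Qed.

Lemma K_mem x : x \in [:: r; s; 'i] -> K x.
Proof. by rewrite KE; apply: gen_field_mem. Qed.

Lemma sigma_K x : K x -> K (sigma x).
Proof.
rewrite KE => h; rewrite KE; apply: rmorph_gen_field h => y.
rewrite -KE !inE => /or3P[] /eqP ->; rewrite ?sigma_i ?sigma_s ?sigma_r.
- by apply: subfN => //; apply: K_mem; rewrite !inE eqxx.
- by apply: K_mem; rewrite !inE eqxx ?orbT.
- by apply: K_mem; rewrite !inE eqxx ?orbT.
Qed.

Lemma tau_K x : K x -> K (tau x).
Proof.
rewrite KE => h; rewrite KE; apply: rmorph_gen_field h => y.
rewrite -KE !inE => /or3P[] /eqP ->; rewrite ?tau_i ?tau_s ?tau_r.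
- by apply: K_mem; rewrite !inE eqxx ?orbT.
- by apply: subfN => //; apply: K_mem; rewrite !inE eqxx ?orbT.
- by apply: K_mem; rewrite !inE eqxx ?orbT.
Qed.

Lemma sigmaK_K x : K x -> sigma (sigma x) = x.
Proof.
move=> /K_coord_r[a [b [Fa Fb ->]]].
by rewrite !rmorphD !rmorphM sigma_r rmorphN sigma_r opprK !(sigma_F Fa, sigma_F Fb).
Qed.

Lemma tauK_K x : K x -> tau (tau x) = x.
Proof.
move=> /K_coord_s[a [b [ka kb ->]]].
by rewrite !rmorphD !rmorphM tau_s rmorphN tau_s opprK !(tau_k ka, tau_k kb).
Qed.

Lemma sigma_tau_comm x : K x -> sigma (tau x) = tau (sigma x).
Proof.
rewrite KE; apply: (@rmorph_eq_gen_field (sigma \o tau) (tau \o sigma)) => y.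
rewrite !inE => /or3P[] /eqP -> /=.
- by rewrite tau_r sigma_r rmorphN /= tau_r.
- by rewrite tau_s sigma_s rmorphN /= sigma_s tau_s.
- by rewrite tau_i sigma_i.
Qed.

Hypothesis r0 : r != 0.

Lemma sigma_fixed x : K x -> sigma x = x -> F x.
Proof.
move=> /K_coord_r[a [b [Fa Fb ->]]].
rewrite rmorphD rmorphM sigma_r !sigma_F // => h.
suff -> : b * r = 0 by rewrite addr0.
apply: (@mulfI _ 2); rewrite ?pnatr_eq0 // mulr0.
have -> : 2 * (b * r) = (a + b * r) - (a + b * - r) by ring.
by rewrite h subrr.
Qed.

Lemma tau_fixed x : K x -> tau x = x -> k x.
Proof.
move=> /K_coord_s[a [b [ka kb ->]]].
rewrite rmorphD rmorphM tau_s !tau_k // => h.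
suff -> : b * s = 0 by rewrite addr0.
apply: (@mulfI _ 2); rewrite ?pnatr_eq0 // mulr0.
have -> : 2 * (b * s) = (a + b * s) - (a + b * - s) by ring.
by rewrite h subrr.
Qed.

(** With beta = z n / c, the usual solution 1 + beta of a0 / sigma(a0) = beta is multiplied by c
    sigma(c), fixed by sigma, to become integral. It vanishes for beta = -1, where r serves
    instead. *)
Lemma hilbert90 n c z : OK k c -> Zi n -> Zi z -> c != 0 -> z * n != 0 ->
    c * sigma c = (z * n) ^+ 2 ->
  exists a0, [/\ OK k a0, a0 != 0 & a0 * c = z * n * sigma a0].
Proof.
move=> Oc zn zz c0 zn0 Nc.
have szn : sigma (z * n) = z * n by apply: sigma_Zi => //; exact: ZiM.
have [e0|e0] := eqVneq (c + z * n) 0.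
  exists r; split=> //; first by apply: OK_quad_r; exact: sqrtn_sqr_Aint.
  have -> : c = - (z * n) by apply/eqP; rewrite -addr_eq0 e0.
  by rewrite sigma_r; ring.
have Osc : OK k (sigma c) by exact: OK_sigma.
have Ozn : OK k (z * n) by apply: OK_Zi; exact: ZiM.
exists (sigma c * (c + z * n)); split.
- by apply: (OKM gfc) => //; exact: (OKD gfc).
- by rewrite mulf_neq0 ?fmorph_eq0.
rewrite rmorphM rmorphD szn (sigmaK_quad (@sqrtn_sqr_gen _ _) sigma_i sigma_r); last by case: Oc.
have -> : sigma c * (c + z * n) * c = (c * sigma c) * c + z * n * (c * sigma c) by ring.
rewrite Nc.
have -> : z * n * (c * (sigma c + z * n)) = z * n * (c * sigma c) + (z * n) ^+ 2 * c by ring.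
by rewrite Nc; ring.
Qed.

Lemma capitulation_in_Ams I : nz_ideal k I -> in_capitulation_kernel K I ->
  in_Ams d%:R k I.
Proof.
move=> nzI; have [iI [x0 [Ix0 x00]]] := nzI; have [IO I0 ID IM] := iI.
move=> [alpha [[Ka Aa] Ia]].
have IOK x : I x -> OK K x by move=> /IO[kx Ax]; split=> //; exact: quad_sub_K.
have Iext x : I x -> ext_ideal K I x by move=> Ix; apply: mem_ideal_gen.
have IaA x : I x -> x / alpha \in Aint.
  move=> /Iext/Ia[y [[_ Ay] ->]].
  have [->|a0] := eqVneq alpha 0; first by rewrite !mul0r.
  by rewrite mulrC mulKf.
have a0 : alpha != 0.
  apply/eqP => a0; move: x00; have [y [_ ->]] := (Ia x0).1 (Iext _ Ix0).
  by rewrite a0 mul0r eqxx.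
have ea : ext_ideal K I alpha.
  by apply/Ia; exists 1; rewrite mulr1; split=> //; exact: OK1.
have [n [zn n0 nI nA]] := ideal_norm_generator (@sqrtn_sqr_gen d [:: 'i]) sigma_i sigma_r nzI.
have sn : sigma n = n by exact: sigma_Zi.
have kn : k n by apply: Qi_sub_quad; exact: Zi_gen_field.
have tn : tau n = n by exact: tau_k.
have sa0 : sigma alpha != 0 by rewrite fmorph_eq0.
have ta0 : tau alpha != 0 by rewrite fmorph_eq0.
have Ksa := sigma_K Ka; have Kta := tau_K Ka.
pose w := alpha * sigma alpha / n.
(* Since alpha lies in I O_K, each of the two factors may be replaced by an element of I; then [nA]
   applies. *)
have wA : w \in Aint.
  rewrite /w -mulrA mulrC.
  apply: (@ext_ideal_semilinear K I idfun) (ea) => // x Ix /=.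
  rewrite mulrC mulrA mulrAC.
  apply: (@ext_ideal_semilinear K I sigma) (ea) => // y Iy.
  by rewrite mulrAC; exact: nA.
(* Conversely n lies in I sigma(I), whose generating products are divisible by alpha
   sigma(alpha). *)
have wiA : w^-1 \in Aint.
  rewrite /w invf_div.
  suff [] : OK k n /\ n / (alpha * sigma alpha) \in Aint by [].
  apply: (@ideal_mul_ind k (fun t => OK k t /\ t / (alpha * sigma alpha) \in Aint)
    _ _ _ _ _ nI) => [|x _ Ix [y [Iy ->]]].
    by apply: ideal_Aint_div => //; exact: (ideal_OK gfc).
  split; first by apply: (OKM gfc); [exact: IO | apply: OK_sigma => //; exact: IO].
  have -> : x * sigma y / (alpha * sigma alpha) = (x / alpha) * sigma (y / alpha).
    by rewrite fmorph_div mulf_div.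
  by rewrite rpredM ?rmorph_Aint ?IaA.
have Kw : K w.
  by apply: subf_div => //; [exact: subfM | exact: quad_sub_K].
have w0 : w != 0 by rewrite !mulf_neq0 ?invr_eq0.
have sw : sigma w = w by rewrite /w fmorph_div rmorphM sn sigmaK_K // [alpha * _]mulrC.
have Fw := sigma_fixed Kw sw.
have wt := unit_norm_sign q4 p_gt4 odd_pq tau_i tau_s Fw w0 wA wiA.
pose c := alpha * tau alpha.
have Kc : K c by exact: subfM.
have kc : k c by apply: tau_fixed => //; rewrite /c rmorphM tauK_K // mulrC.
have Ac : c \in Aint by rewrite rpredM ?rmorph_Aint.
have c0 : c != 0 by rewrite mulf_neq0.
have Nc : c * sigma c = (w * tau w) * n ^+ 2.
  rewrite /c /w rmorphM fmorph_div rmorphM sigma_tau_comm // tn.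
  by field; rewrite ?n0.
have taA : tau alpha / alpha \in Aint.
  rewrite mulrC; apply: (@ext_ideal_semilinear K I tau) (ea) => // x Ix.
  by rewrite tau_k ?[_^-1 * _]mulrC ?IaA //; case: (IO _ Ix).
(* The square root exists because the relative norm of w is 1 or -1, and i lies in the base
   field. *)
have [z [zz zi z2]] : exists z, [/\ Zi z, z^-1 \in Aint & z ^+ 2 = w * tau w].
  case: wt => ->.
    by exists 1; rewrite invr1 expr1n; split=> //; exact: Zi1.
  by exists 'i; rewrite invCi sqr_i rpredN; split=> //; [exact: Zi_i | exact: Aint_i].
have z0 : z != 0 by rewrite -sqrf_eq0 z2 mulf_neq0 ?fmorph_eq0.
have zn0 : z * n != 0 by rewrite mulf_neq0.
have Nc2 : c * sigma c = (z * n) ^+ 2 by rewrite Nc exprMn z2.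
have [b [Ob b0 bE]] := hilbert90 (conj kc Ac) zn zz c0 zn0 Nc2.
(* I O_K meets k in I. As n lies in I sigma(I), y = n (y / n) is a sum of terms x (sigma(x') y / n)
   with x, x' in I, and the second factor is integral because y / alpha is. *)
have contr y : k y -> y / alpha \in Aint -> I y.
  move=> ky yA.
  suff [_] : OK k n /\ I (n * (y / n)) by rewrite mulrC divfK.
  apply: (@ideal_mul_ind k (fun t => OK k t /\ I (t * (y / n))) _ _ _ _ _ nI) => [|x _ Ix [x' [Ix' ->]]].
    split=> [t []//||t t' [Ot It] [Ot' It']|t t' Ot [Ot' It]].
    - by split; [exact: (OK0 gfc) | rewrite mul0r].
    - by split; [exact: (OKD gfc) | rewrite mulrDl; exact: ID].
    - by split; [exact: (OKM gfc) | rewrite -mulrA; exact: IM].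
  have Osx' : OK k (sigma x') by apply: OK_sigma => //; exact: IO.
  split; first by apply: (OKM gfc) => //; exact: IO.
  rewrite -mulrA mulrC; apply: IM => //; split.
    by apply: (subfM gfc); [case: Osx' | exact: (subf_div gfc)].
  have -> : sigma x' * (y / n) = (y / alpha) * sigma (x' / alpha) * w.
    by rewrite fmorph_div /w; field; rewrite ?n0 ?a0 ?sa0.
  by rewrite rpredM // rpredM // rmorph_Aint ?IaA.
pose J z := exists y, I y /\ z = b * y.
have nzJ : nz_ideal k J.
  split; last by exists (b * x0); split; [exists x0 | rewrite mulf_neq0].
  split=> [_ [y [Iy ->]]||_ _ [x [Ix ->]] [y [Iy ->]]|a _ Oa [y [Iy ->]]].
  - by apply: (OKM gfc) => //; exact: IO.
  - by exists 0; rewrite mulr0.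
  - by exists (x + y); split; [exact: ID | rewrite mulrDr].
  - by exists (a * y); split; [exact: IM | rewrite mulrCA].
have sJ : sigma_invariant d%:R J.
  move=> u ui ur _ [y [Iy ->]].
  have [ky Ay] := IO _ Iy; have [kb Ab] := Ob.
  have us x : k x -> u x = sigma x.
    apply: rmorph_eq_gen_field => t; rewrite !inE => /orP[] /eqP ->.
      by rewrite sigma_r; exact: ur.
    by rewrite ui sigma_i.
  rewrite us; last exact: (subfM gfc).
  rewrite rmorphM; exists (sigma b * sigma y / b); split; last by rewrite [RHS]mulrC divfK.
  apply: contr.
    apply: (subf_div gfc) => //; apply: (subfM gfc); exact: sigma_quad.
  (* Insert sigma(b) / b = c / (z n). The three factors are integral: z is a unit, tau(alpha) lies
     in the tau-stable ideal (alpha), and sigma(y) / sigma(alpha) is the conjugate of an integer. *)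
  have -> : sigma b * sigma y / b / alpha = z^-1 * (tau alpha / alpha) * (w * sigma (y / alpha)).
    have -> : sigma b = b * c / (z * n) by rewrite bE mulrC mulKf // mulf_neq0.
    by rewrite /w /c fmorph_div; field; rewrite ?n0 ?a0 ?sa0 ?z0 ?b0.
  by rewrite rpredM //; rewrite rpredM // rmorph_Aint ?IaA.
(* I and b I are in the same class, so a single invariant ideal and an empty product suffice. *)
exists 1%N, 0%N, (fun _ => J), (fun _ => OK k); split=> //.
exists b, 1; split=> //; [exact: (OK1 gfc) | exact: oner_neq0 |].
have [iJ _] := nzJ.
move=> x; split=> [[y [/(ideal_mulr1 _ gfc iI) Iy ->]]|[_ [/(ideal_mul1r _ gfc iJ) [y [Iy ->]] ->]]].
  exists (b * y); rewrite mul1r; split=> //; apply/(ideal_mul1r _ gfc iJ); by exists y.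
by exists y; rewrite mul1r; split=> //; apply/(ideal_mulr1 _ gfc iI).
Qed.

End CapitulationKernel.

(** * Pell equations *)

Section River.

Variable D : int.
Hypothesis Dns : forall x : int, x * x <> D.
Hypothesis D_gt0 : 0 < D.

(* (a, b, c) is the form a x^2 + 2 b x y - c y^2 of determinant -D, i.e. the
   form x^2 - D y^2 read in a basis v, w on both sides of Conway's river; a step
   replaces v or w by v + w. The river is finite and steps are injective, so the
   walk from (1, 0, D) returns to its start, where v solves Pell's equation. *)
Definition river_step (f : int * int * int) : int * int * int :=
  let: (a, b, c) := f in
  if 0 < a + 2 * b - c then (a + 2 * b - c, b - c, c)
  else (a, b + a, c - 2 * b - a).

Definition on_river (f : int * int * int) :=
  let: (a, b, c) := f in [/\ 0 < a, 0 < c & b * b + a * c = D].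

Lemma river_step_on f : on_river f -> on_river (river_step f).
Proof.
case: f => [[a b] c] [a0 c0 e] /=; case: ifP => h; split=> //; try lia.
(* The form does not vanish at v + w: otherwise D = (a + b)^2. *)
suff : a + 2 * b - c <> 0 by lia.
move=> t0; apply: (Dns (x := a + b)); rewrite -e.
have -> : c = a + 2 * b by lia.
by ring.
Qed.

(** The branch taken can be read off the result (a1, b1, c1): a1 - 2 b1 - c1 equals the old a in the
    first branch and minus the old c in the second. *)
Lemma river_step_inj f g : on_river f -> on_river g ->
  river_step f = river_step g -> f = g.
Proof.
case: f => [[a b] c] [a0 c0 _]; case: g => [[a' b'] c'] [a0' c0' _] /=.
case: ifP => h; case: ifP => h' [e1 e2 e3].
- by have [-> [-> ->]] : a = a' /\ b = b' /\ c = c' by lia.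
- by lia.
- by lia.
- by have [-> [-> ->]] : a = a' /\ b = b' /\ c = c' by lia.
Qed.

Definition river n := iter n river_step (1, 0, D).

Lemma river_on n : on_river (river n).
Proof.
elim: n => [|n IH]; last exact: river_step_on.
by split; rewrite ?mul1r ?mul0r ?add0r.
Qed.

Lemma river_periodic : exists2 n, (0 < n)%N & river n = river 0.
Proof.
pose rng := [seq (Posz i - D) | i <- iota 0 (absz D).*2.+1].
have mem_rng x : - D <= x <= D -> x \in rng.
  move=> hx; apply/mapP; exists (absz (x + D)); last by lia.
  by rewrite mem_iota; lia.
pose l := [seq (ab, c) | ab <- [seq (a, b) | a <- rng, b <- rng], c <- rng].
(* With a, c > 0, the relation b^2 + a c = D bounds every entry by D. *)
have mem_l n : river n \in l.
  have := river_on n; case: (river n) => [[a b] c] [a0 c0 e].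
  apply: allpairs_f; last by apply: mem_rng; nia.
  by apply: allpairs_f; apply: mem_rng; nia.
pose s := map river (iota 0 (size l).+1).
have : ~~ uniq s.
  apply/negP => us; have : {subset s <= l} by move=> _ /mapP[n _ ->].
  by move=> /(uniq_leq_size us); rewrite size_map size_iota ltnn.
move=> /(uniqPn (river 0)) [i [j [ij]]].
rewrite size_map size_iota => js.
rewrite !(nth_map 0%N) ?size_iota ?nth_iota ?add0n //; try exact: (ltn_trans ij js).
move=> e; exists (j - i)%N; first by rewrite subn_gt0.
rewrite -(subnKC (ltnW ij)) in e.
(* Injectivity of the step strips the common initial segment of length i, so the repetition occurs
   at 0. *)
move: {js ij}(j - i)%N e => m; elim: i => [//|i IH e].
by apply: IH; apply: river_step_inj; [exact: river_on | exact: river_on | exact: e].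
Qed.

(** The last disjunction keeps the trivial solution out: as long as v is still (1, 0), every step
    has added v to w, so b counts the steps. A return to b = 0 at some n > 0 thus forces v2 > 0. *)
Lemma river_basis n : let: (a, b, c) := river n in
  exists v1 v2 w1 w2 : int,
    [/\ v1 * v1 - D * (v2 * v2) = a, w1 * w1 - D * (w2 * w2) = - c
      & v1 * w1 - D * (v2 * w2) = b] /\
    [/\ 0 <= v2, 0 < w2 & 0 < v2 \/ (a = 1 /\ b = n)].
Proof.
elim: n => [|n]; first by exists 1, 0, 0, 1; split; split=> //; try lia; right.
have := river_on n; rewrite /river /=; case: (iter n _ _) => [[a b] c] [a0 c0 e].
move=> [v1 [v2 [w1 [w2 [[va wc vwb] [v20 w20 h]]]]]] /=.
case: ifP => t.
  exists (v1 + w1), (v2 + w2), w1, w2; split; split=> //; try lia.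
exists v1, v2, (v1 + w1), (v2 + w2); split; split=> //; try lia.
Qed.

Lemma pell : exists x y : int, 0 < y /\ x * x = D * (y * y) + 1.
Proof.
have [n n0 rn] := river_periodic.
have := river_basis n; rewrite rn /= => -[v1 [v2 [w1 [w2 [[va _ _] [_ _ h]]]]]].
by exists v1, v2; split; [case: h => //; lia | lia].
Qed.

End River.

(** The square of gcd(u, y) is gcd(u^2, u y, y^2) = u gcd(u, y, v), since y^2 = u v. *)
Lemma coprime_mul_sqr u v y : coprime u v -> (u * v = y * y)%N -> u = (gcdn u y * gcdn u y)%N.
Proof.
move=> cuv uv; rewrite muln_gcdl !muln_gcdr -uv [(y * u)%N]mulnC.
rewrite -!muln_gcdr; have -> : gcdn (gcdn u y) (gcdn y v) = 1%N.
  apply/eqP; rewrite -dvdn1 -(eqP cuv) dvdn_gcd.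
  rewrite (dvdn_trans (dvdn_gcdl _ _) (dvdn_gcdl _ _)).
  by rewrite (dvdn_trans (dvdn_gcdr _ _) (dvdn_gcdr _ _)).
by rewrite muln1.
Qed.

(** Modulo 4, X = 2 h + 1 and Y = 2 y, so h (h + 1) = p y^2 with coprime factors: one is a square
    and the other p times a square. If p divides h + 1, this is the equation sought; if p divides h,
    it is a Pell solution with smaller Y. *)
Lemma pell_neg_descent p Y X : prime p -> (p %% 4 = 1)%N -> (0 < Y)%N ->
  (X * X = p * (Y * Y) + 1)%N -> exists x y, (x * x + 1 = p * (y * y))%N.
Proof.
move=> pp p4; elim/ltn_ind: Y X => Y IH X Y0 e.
have [k pk] : exists k, p = (4 * k + 1)%N.
  by exists (p %/ 4)%N; rewrite {1}(divn_eq p 4) p4 mulnC.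
have [h [y [Xh Yy]]] : exists h y, X = (2 * h + 1)%N /\ Y = (2 * y)%N.
  exists X./2, Y./2; move: (odd_double_half X) (odd_double_half Y).
  rewrite -!mul2n; move: (X./2) (Y./2) => x y.
  move: e; rewrite pk; clear.
  by case: (odd X); case: (odd Y) => /= e hx hy; subst X Y; lia.
have hy : (h * (h + 1) = p * (y * y))%N by rewrite Xh Yy in e; lia.
have y0 : (0 < y)%N by lia.
have h0 : (0 < h)%N by have := prime_gt0 pp; case: (h) hy => //; nia.
have ch : coprime h (h + 1) by rewrite addn1 coprimenS.
have : ((p %| h) || (p %| h + 1))%N by rewrite -Euclid_dvdM // hy dvdn_mulr.
case/orP=> /dvdnP[g gE].
  have gy : (g * (h + 1) = y * y)%N.
    by apply/eqP; rewrite -(eqn_pmul2l (prime_gt0 pp)) -hy mulnA [(p * g)%N]mulnC -gE.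
  have cg : coprime g (h + 1) by move: ch; rewrite {1}gE coprimeMl => /andP[].
  have gs := coprime_mul_sqr cg gy.
  have ht : (h + 1 = gcdn (h + 1) y * gcdn (h + 1) y)%N.
    by apply: (coprime_mul_sqr (v := g)); rewrite 1?coprime_sym // mulnC.
  move: gs ht; set s := gcdn g y; set t := gcdn (h + 1) y => gs ht.
  have g0 : (0 < g)%N by case: (g) gE h0 => // ->.
  have sy : (s <= y)%N by rewrite /s dvdn_leq // dvdn_gcdr.
  apply: (IH s _ t); [lia | by rewrite /s gcdn_gt0 g0 |].
  by rewrite -ht -gs gE mulnC.
have gy : (g * h = y * y)%N.
  by apply/eqP; rewrite -(eqn_pmul2l (prime_gt0 pp)) -hy mulnA [(p * g)%N]mulnC -gE mulnC.
have cg : coprime g h.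
  by move: ch; rewrite coprime_sym {1}gE coprimeMl => /andP[].
have gs := coprime_mul_sqr cg gy.
have ht : (h = gcdn h y * gcdn h y)%N.
  by apply: (coprime_mul_sqr (v := g)); rewrite 1?coprime_sym // mulnC.
by exists (gcdn h y), (gcdn g y); rewrite -ht -gs gE mulnC.
Qed.

Lemma pell_neg p : prime p -> (p %% 4 = 1)%N -> exists x y, (x * x + 1 = p * (y * y))%N.
Proof.
move=> pp p4.
have Dns (x : int) : x * x <> p.
  move=> h; have := congr1 absz h; rewrite abszM absz_nat => e.
  have m0 : (0 < absz x)%N by case: (absz x) e => // e; rewrite -e in pp.
  have := congr1 odd (congr1 (logn p) e).
  by rewrite lognM // addnn odd_double logn_prime ?eqxx.
have p0 : 0 < (p : int) by have := prime_gt0 pp; lia.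
have [x [y [y0 xy]]] := pell Dns p0.
apply: (@pell_neg_descent p (absz y) (absz x)) => //; first by lia.
by apply/eqP; rewrite -eqz_nat; apply/eqP; lia.
Qed.

(** * Square roots of Gaussian integers up to units *)

(** b ranges over L, not only over its integers, so that these z form a group. *)
Definition unit_sqr (L : algC -> Prop) z := exists u b,
  [/\ L u, u \in Aint & u^-1 \in Aint] /\ [/\ L b, b != 0, u != 0 & z = u * b ^+ 2].

Section UnitSquares.
Variables (L : algC -> Prop) (Lf : Defs.subfield_closed L).

Lemma unit_sqrM z t : unit_sqr L z -> unit_sqr L t -> unit_sqr L (z * t).
Proof.
move=> [u [b [[Lu Au Aiu] [Lb b0 u0 ->]]]] [v [c [[Lv Av Aiv] [Lc c0 v0 ->]]]].
exists (u * v), (b * c); split; split.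
- exact: subfM.
- by rewrite rpredM.
- by rewrite invfM rpredM.
- exact: subfM.
- by rewrite mulf_neq0.
- by rewrite mulf_neq0.
- by rewrite exprMn mulrACA.
Qed.

Lemma unit_sqrV z : unit_sqr L z -> unit_sqr L z^-1.
Proof.
move=> [u [b [[Lu Au Aiu] [Lb b0 u0 ->]]]].
exists u^-1, b^-1; split; split; rewrite ?invrK ?invr_eq0 //; try exact: subfV.
by rewrite invfM exprVn.
Qed.

Lemma unit_sqr_div z t : unit_sqr L z -> unit_sqr L t -> unit_sqr L (z / t).
Proof. by move=> hz ht; apply/unit_sqrM/unit_sqrV. Qed.

Lemma unit_sqr_sqr b : L b -> b != 0 -> unit_sqr L (b ^+ 2).
Proof.
move=> Lb b0; exists 1, b; rewrite invr1 mul1r oner_neq0.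
by split; split=> //; exact: subf1.
Qed.

Hypothesis Li : L 'i.

Lemma Zi_sub z : Zi z -> L z.
Proof.
move=> [a [b ->]]; apply: subfD => //; first exact: subf_int.
by apply: subfM => //; exact: subf_int.
Qed.

Lemma unit_sqr_Zi_unit z t : Zi z -> Zi t -> z * t = 1 -> unit_sqr L z.
Proof.
move=> zz zt zt1; have z0 : z != 0.
  by apply/eqP => z0; move: zt1; rewrite z0 mul0r => /esym /eqP; rewrite oner_eq0.
exists z, 1; rewrite expr1n mulr1 oner_neq0.
have -> : z^-1 = t by rewrite -[t](mulKf z0) zt1 mulr1.
by split; split=> //; [exact: Zi_sub | exact: Zi_Aint | exact: Zi_Aint | exact: subf1].
Qed.

(* With eps = x + y sqrt p of norm -1, i eps has relative norm 1 over Q(i), and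
   (1 + i eps)^2 = 2 i eps (1 + i x). *)
Lemma unit_sqr_pell p x y : L (sqrtn p) -> (x * x + 1 = p * (y * y))%N ->
  unit_sqr L (1 + 'i * x%:R).
Proof.
move=> Lp e; pose eps := x%:R + y%:R * sqrtn p; pose eps' := y%:R * sqrtn p - x%:R.
have ee : eps * eps' = 1.
  have -> : eps * eps' = y%:R ^+ 2 * sqrtn p ^+ 2 - x%:R ^+ 2 by rewrite /eps /eps'; ring.
  rewrite sqrtn_sqr -!natrX -natrM.
  have -> : (y ^ 2 * p = x ^ 2 + 1)%N by rewrite -!mulnn e mulnC.
  by rewrite natrD addrC addKr.
have eps0 : eps != 0 by apply/eqP => e0; move: ee; rewrite e0 mul0r => /esym /eqP; rewrite oner_eq0.
have epsV : eps^-1 = eps' by rewrite -[eps'](mulKf eps0) ee mulr1.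
have Leps : L eps by apply: subfD => //; [exact: subf_nat | apply: subfM => //; exact: subf_nat].
have Aeps : eps \in Aint by rewrite rpredD ?rpredM ?Aint_sqrtn ?rpred_nat.
have Aeps' : eps' \in Aint by rewrite rpredB ?rpredM ?Aint_sqrtn ?rpred_nat.
have i1 : 1 + 'i != 0 :> algC.
  apply/eqP => h; have : (1 + 'i) * (1 - 'i) = 2 :> algC by ring: mulCii.
  by rewrite h mul0r => /eqP; rewrite eq_sym pnatr_eq0.
pose b := (1 + 'i * eps) / (1 + 'i).
have b2 : b ^+ 2 = eps * (1 + 'i * x%:R).
  apply: (@mulIf _ ((1 + 'i) ^+ 2)); first by rewrite expf_neq0.
  rewrite /b -exprMn divfK //.
  have e2 : eps * eps = 2 * x%:R * eps + 1.
    have -> : eps * eps = 2 * x%:R * eps + eps * eps' by rewrite /eps' /eps; ring.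
    by rewrite ee.
  have -> : (1 + 'i * eps) ^+ 2 = 1 + 2 * 'i * eps + ('i * 'i) * (eps * eps) by ring.
  rewrite e2; ring: mulCii.
have x0 : 1 + 'i * x%:R != 0 :> algC.
  apply/eqP => h; have : (1 + 'i * x%:R) * (1 - 'i * x%:R) = (1 + x * x)%:R :> algC.
    by rewrite natrD natrM; ring: mulCii.
  by rewrite h mul0r => /eqP; rewrite eq_sym pnatr_eq0.
exists eps^-1, b; split; split; rewrite ?invrK ?invr_eq0 //.
- exact: subfV.
- by rewrite epsV.
- apply: subf_div => //; apply: subfD => //; try exact: subf1.
  exact: subfM.
- by rewrite -sqrf_eq0 b2 mulf_neq0.
- by rewrite b2 mulKf.
Qed.

(* With x^2 + 1 = p y^2 and g = gcd(1 + i x, y), one has g g^* = y, and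
   z = (1 + i x) / g^2 has norm p. *)
Lemma Zi_prime_split p : prime p -> (p %% 4 = 1)%N -> L (sqrtn p) ->
  exists z, [/\ Zi z, z * z^* = p%:R & unit_sqr L z].
Proof.
move=> pp p4 Lp; have [x [y e]] := pell_neg pp p4.
have SA := unit_sqr_pell Lp e; move: SA; set A := 1 + _ => SA.
(* An even y would give x^2 = -1 mod 4. *)
have [m ym] : exists m, y = (2 * m + 1)%N.
  have [k pk] : exists k, p = (4 * k + 1)%N.
    by exists (p %/ 4)%N; rewrite {1}(divn_eq p 4) p4 mulnC.
  exists y./2; move: (odd_double_half x) (odd_double_half y).
  rewrite -!mul2n; move: (x./2) (y./2) => x2 y2.
  move: e; rewrite pk; clear.
  by case: (odd x); case: (odd y) => /= e hx hy; subst x y; lia.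
have y0 : y%:R != 0 :> algC by rewrite pnatr_eq0 ym addn1.
have ZA : Zi A by apply: ZiD; [exact: Zi1 | apply: ZiM; [exact: Zi_i | exact: Zi_nat]].
have Ac : A^* = 1 - 'i * x%:R.
  by rewrite /A rmorphD rmorphM rmorph1 rmorph_nat /= conjC_i mulNr.
have NA : A * A^* = p%:R * y%:R ^+ 2.
  rewrite Ac /A -natrX -natrM -mulnn -e natrD natrM; ring: mulCii.
have ZAc := Zi_conj ZA.
(* A and its conjugate add up to 2 and y = 2 m + 1, so the three together generate the unit
   ideal. *)
have cop : 1 = y%:R - m%:R * A - m%:R * A^* :> algC.
  by rewrite Ac /A ym natrD natrM; ring.
have A0 : A != 0.
  have pnz : p%:R != 0 :> algC by rewrite pnatr_eq0 -lt0n prime_gt0.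
  apply/eqP => A0; move: NA; rewrite A0 mul0r => /esym/eqP.
  by rewrite mulf_eq0 sqrf_eq0 (negPf y0) (negPf pnz).
have [g [u [v [A' [y' [[Zu Zv ZA' Zy'] [gE AE yE]]]]]]] := Zi_bezout ZA (Zi_nat y) A0.
have yc : (y%:R)^* = y%:R :> algC by rewrite rmorph_nat.
have g0 : g != 0 by apply: contraNneq A0 => g0; rewrite AE g0 mulr0.
have Zg : Zi g by rewrite gE; apply: ZiD; apply: ZiM => //; exact: Zi_nat.
have Zm := Zi_nat m; have Zy := Zi_nat y; have Zp := Zi_nat p.
have Zgc := Zi_conj Zg; have Zuc := Zi_conj Zu; have Zvc := Zi_conj Zv.
have ZA'c := Zi_conj ZA'; have Zy'c := Zi_conj Zy'.
have gcE : g^* = u^* * A^* + v^* * y%:R by rewrite gE rmorphD !rmorphM /= yc.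
have AcE : A^* = A'^* * g^* by rewrite AE rmorphM.
have ycE : y%:R = y'^* * g^* by rewrite -[LHS]yc yE rmorphM.
(* Expanding g conj(g) with A conj(A) = p y^2 exhibits [z1] as a cofactor of y; [z2] goes the other
   way, by multiplying [cop] by y. So z1 is a unit of Z[i], and being nonnegative it is 1. *)
pose z1 := u * u^* * p%:R * y%:R + u * v^* * A + v * u^* * A^* + v * v^* * y%:R.
have gz1 : g * g^* = y%:R * z1.
  rewrite gcE [X in X * _]gE.
  have -> : (u * A + v * y%:R) * (u^* * A^* + v^* * y%:R) =
    u * u^* * (A * A^*) + y%:R * (u * v^* * A + v * u^* * A^* + v * v^* * y%:R) by ring.
  by rewrite NA /z1; ring.
pose z2 := y' * y'^* - m%:R * A' * y'^* - m%:R * A'^* * y'.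
have yz2 : y%:R = g * g^* * z2.
  have -> : y%:R = y%:R * y%:R - m%:R * A * y%:R - m%:R * A^* * y%:R :> algC.
    transitivity (y%:R * 1 : algC); first by rewrite mulr1.
    by rewrite [X in _ * X = _]cop; ring.
  have -> : y%:R * y%:R = (y' * g) * (y'^* * g^*) by rewrite -yE -ycE.
  have -> : m%:R * A * y%:R = m%:R * (A' * g) * (y'^* * g^*) by rewrite -AE -ycE.
  have -> : m%:R * A^* * y%:R = m%:R * (A'^* * g^*) * (y' * g) by rewrite -AcE -yE.
  by rewrite /z2; ring.
have Zz1 : Zi z1 by do ?apply: ZiD; do ?apply: ZiM.
have Zz2 : Zi z2 by do ?apply: ZiB; do ?apply: ZiM.
have z12 : z1 * z2 = 1.
  by apply: (mulfI y0); rewrite mulr1 mulrA -gz1 -yz2.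
have gy : g * g^* = y%:R.
  suff z11 : z1 = 1 by rewrite gz1 z11 mulr1.
  have z1E : z1 = (g * g^*) / y%:R by rewrite gz1 mulrAC divff // mul1r.
  have z1_ge0 : 0 <= z1 by rewrite z1E divr_ge0 ?ler0n ?mul_conjC_ge0.
  have := Zi_unit Zz1 Zz2 z12; rewrite !inE => /or4P[] /eqP // h.
  - by move: z1_ge0; rewrite h oppr_ge0 real_leNgt ?ltr01 ?rpred1 ?rpred0.
  - by have := ger0_real z1_ge0; rewrite h => /CrealP/eqP;
      rewrite conjC_i eq_sym -addr_eq0 -mulr2n mulrn_eq0 /= (negPf (neq0Ci algC)).
  - by have := ger0_real z1_ge0; rewrite h realN => /CrealP/eqP;
      rewrite conjC_i eq_sym -addr_eq0 -mulr2n mulrn_eq0 /= (negPf (neq0Ci algC)).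
(* Now [cop] says that g and conj(A) are comaximal, hence so are g^2 and conj(A). As g^2 divides A
   conj(A) = p y^2, it divides A, with quotient [z]. *)
pose e1 := y' - m%:R * A'.
have bz : 1 = g * e1 - m%:R * A^*.
  by rewrite [LHS]cop {1}yE {1}AE /e1; ring.
pose f := m%:R * (m%:R * A^* - 2 * g * e1).
have bz2 : 1 = g ^+ 2 * e1 ^+ 2 + A^* * f.
  transitivity ((g * e1 - m%:R * A^*) ^+ 2); first by rewrite -bz expr1n.
  by rewrite /f; ring.
pose z := A * e1 ^+ 2 + p%:R * g^* ^+ 2 * f.
have Ze1 : Zi e1 by apply: ZiB => //; exact: ZiM.
have Z2 := Zi_nat 2.
have Zf : Zi f by apply: ZiM => //; apply: ZiB; do ?apply: ZiM.
have Zz : Zi z by apply: ZiD; do ?apply: ZiM => //; exact: ZiX.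
have Az : A = g ^+ 2 * z.
  transitivity (A * 1); first by rewrite mulr1.
  rewrite [X in _ * X = _]bz2 /z.
  have -> : A * (g ^+ 2 * e1 ^+ 2 + A^* * f) = A * g ^+ 2 * e1 ^+ 2 + (A * A^*) * f by ring.
  by rewrite NA -gy; ring.
exists z; split=> //.
  apply: (mulfI (expf_neq0 2 y0)); rewrite [RHS]mulrC -NA.
  have -> : A^* = g^* ^+ 2 * z^* by rewrite {1}Az rmorphM rmorphXn.
  by rewrite -gy Az; ring.
have -> : z = A / g ^+ 2 by rewrite Az mulrC mulKf // expf_neq0.
by apply: unit_sqr_div => //; apply: unit_sqr_sqr => //; exact: Zi_sub.
Qed.

(** The norm of gcd(z, s) divides the prime p. Either the gcd is associated to z, which cancels from
    s, or it is a unit and s divides t; both ways s, possibly divided by z, divides t, as an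
    induction over prime factors requires. *)
Lemma Zi_prime_dvd p z s s' t : prime p -> z * z^* = p%:R ->
    Zi z -> Zi s -> Zi s' -> Zi t -> s * s' = z * t ->
  (exists t', Zi t' /\ t = s * t') \/ (exists s1, [/\ Zi s1, s = z * s1 & s1 * s' = t]).
Proof.
move=> pp zp Zz Zs Zs' Zt e.
have z0 : z != 0.
  apply/eqP => z0; move: zp; rewrite z0 mul0r => /esym/eqP.
  by rewrite pnatr_eq0 => /eqP p0; rewrite p0 in pp.
have [g [u [v [z' [s'' [[Zu Zv Zz' Zs''] [gE zE sE]]]]]]] := Zi_bezout Zz Zs z0.
have Zg : Zi g by rewrite gE; apply: ZiD; apply: ZiM.
have [[a ga] [b z'b]] := (Zi_norm Zg, Zi_norm Zz').
have ba : (b * a)%N = p.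
  apply/eqP; rewrite -(eqr_nat algC) natrM -zp zE rmorphM -ga -z'b; apply/eqP; ring.
have : (b == 1)%N || (b == p).
  by apply: (primeP pp).2; rewrite -ba dvdn_mulr.
case/orP=> /eqP bE.
  right; have Nz' : z' * z'^* = 1 by rewrite z'b bE.
  have gz : g = z * z'^*.
    by rewrite {1}zE mulrAC Nz' mul1r.
  exists (s'' * z'^*); split; first by apply: ZiM => //; exact: Zi_conj.
    by rewrite {1}sE gz; ring.
  apply: (mulfI z0); by rewrite -e sE gz; ring.
left; have Ng : g * g^* = 1.
  rewrite ga; suff -> : a = 1%N by [].
  apply/eqP; rewrite -(eqn_pmul2l (prime_gt0 pp)) muln1 -{2}ba bE //.
exists (g^* * (u * s' + v * t)); split.
  by apply: ZiM; [exact: Zi_conj | apply: ZiD; apply: ZiM].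
rewrite -[LHS]mul1r -Ng [X in X * _ * _]gE.
have -> : (u * z + v * s) * g^* * t = g^* * (u * (z * t) + v * s * t) by ring.
by rewrite -e; ring.
Qed.

Lemma unit_sqr_dvd_prod (l : seq algC) s s' :
    (forall z, z \in l -> [/\ Zi z, unit_sqr L z & exists2 p, prime p & z * z^* = p%:R]) ->
  Zi s -> Zi s' -> s * s' = \prod_(z <- l) z -> unit_sqr L s.
Proof.
elim: l s s' => [|z l IH] s s' hl Zs Zs'; first by rewrite big_nil; exact: unit_sqr_Zi_unit.
have hl' t : t \in l -> [/\ Zi t, unit_sqr L t & exists2 p, prime p & t * t^* = p%:R].
  by move=> tl; apply: hl; rewrite inE tl orbT.
have Zt : Zi (\prod_(t <- l) t).
  rewrite big_seq; elim/big_rec: _ => [|t x tl Zx]; first exact: Zi1.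
  by apply: ZiM => //; case: (hl' t tl).
have [Zz Sz [p pp zp]] := hl z (mem_head _ _).
rewrite big_cons => /(Zi_prime_dvd pp zp Zz Zs Zs' Zt) [[t' [Zt' tE]]|[s1 [Zs1 sE tE]]].
  exact: (IH s t').
by rewrite sE; apply: unit_sqrM => //; apply: (IH s1 s').
Qed.

Lemma unit_sqr_dvd p1 p2 s s' : prime p1 -> prime p2 -> (p1 %% 4 = 1)%N -> (p2 %% 4 = 1)%N ->
    L (sqrtn 2) -> L (sqrtn p1) -> L (sqrtn p2) -> Zi s -> Zi s' ->
  s * s' = 4 * (2 * p1 * p2)%:R ^+ 2 -> unit_sqr L s.
Proof.
move=> pp1 pp2 p14 p24 L2 L1 L2' Zs Zs' e.
have good z p : prime p -> Zi z -> z * z^* = p%:R -> unit_sqr L z ->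
  [/\ Zi z, unit_sqr L z & exists2 p, prime p & z * z^* = p%:R].
  by move=> pp Zz zp Sz; split=> //; exists p.
have good_conj z p : prime p -> L (sqrtn p) -> Zi z -> z * z^* = p%:R -> unit_sqr L z ->
  [/\ Zi z^*, unit_sqr L z^* & exists2 p, prime p & z^* * z^*^* = p%:R].
  move=> pp Lp Zz zp Sz; split; [exact: Zi_conj | | by exists p => //; rewrite conjCK mulrC].
  have p0 : p%:R != 0 :> algC by rewrite pnatr_eq0 -lt0n prime_gt0.
  have z0 : z != 0 by apply: contraNneq p0 => z0; rewrite -zp z0 mul0r.
  have -> : z^* = sqrtn p ^+ 2 / z by rewrite sqrtn_sqr -zp mulrC mulKf.
  by apply: unit_sqr_div => //; apply: unit_sqr_sqr; rewrite // -sqrf_eq0 sqrtn_sqr.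
have [z1 [Zz1 z1p Sz1]] := Zi_prime_split pp1 p14 L1.
have [z2 [Zz2 z2p Sz2]] := Zi_prime_split pp2 p24 L2'.
have S2 : unit_sqr L (1 + 'i).
  by have := unit_sqr_pell (p := 2) (x := 1) (y := 1) L2 erefl; rewrite mulr1.
(* 4 d^2 = 16 p1^2 p2^2, where 16 = (1 + i)^8 and each p is a product of two conjugates. *)
apply: (@unit_sqr_dvd_prod (nseq 8 (1 + 'i) ++
  [:: z1; z1^*; z1; z1^*; z2; z2^*; z2; z2^*]) s s' _ Zs Zs').
  move=> z; rewrite mem_cat mem_nseq => /orP[/andP[_ /eqP ->]|].
    apply: (good _ 2%N) => //; first by apply: ZiD; [exact: Zi1 | exact: Zi_i].
    rewrite rmorphD rmorph1 /= conjC_i; ring: mulCii.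
  have g1 := good _ _ pp1 Zz1 z1p Sz1; have g1' := good_conj _ _ pp1 L1 Zz1 z1p Sz1.
  have g2 := good _ _ pp2 Zz2 z2p Sz2; have g2' := good_conj _ _ pp2 L2' Zz2 z2p Sz2.
  by rewrite !inE => h; repeat (case/orP: h => [/eqP -> //|h]); move/eqP: h => ->.
rewrite e big_cat /= !big_cons !big_nil !natrM -z1p -z2p.
ring: mulCii.
Qed.

End UnitSquares.

(** * Capitulation of strongly ambiguous classes *)

Section Extension.
Variables (k L : algC -> Prop).
Hypotheses (kf : Defs.subfield_closed k) (Lf : Defs.subfield_closed L).
Hypothesis kL : forall x, k x -> L x.

Lemma OK_sub x : OK k x -> OK L x.
Proof. by move=> [kx Ax]; split=> //; exact: kL. Qed.

Lemma ext_ideal_ideal I : (forall x, I x -> OK k x) -> ideal L (ext_ideal L I).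
Proof. by move=> IO; apply: ideal_gen_ideal => // x /IO /OK_sub. Qed.

Lemma ext_ideal_mulr I E c a : (forall x, I x -> OK k x) -> ideal L E ->
  (forall x, I x -> E (c * x)) -> ext_ideal L I a -> E (c * a).
Proof.
move=> IO [EO E0 ED EM] h /(_ (fun z => OK L z /\ E (c * z))) [||//].
  split=> [z []//||y z [Ky Ay] [Kz Az]|t z Kt [Kz Az]].
  - by split; [exact: OK0 | rewrite mulr0].
  - by split; [exact: OKD | rewrite mulrDr; exact: ED].
  - by split; [exact: OKM | rewrite mulrCA; exact: EM].
by move=> y Iy; split; [apply/OK_sub/IO | exact: h].
Qed.

(** I O_L = (a), split into its two inclusions; the first is stated on I alone, and a need not be
    assumed integral. *)
Definition ext_generated I a :=
  [/\ L a, a != 0, (forall x, I x -> x / a \in Aint) & ext_ideal L I a].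

Lemma ext_generated_principal I a : (forall x, I x -> OK k x) ->
  ext_generated I a -> in_capitulation_kernel L I.
Proof.
move=> IO [La a0 Ia Ea]; have iE := ext_ideal_ideal IO; have [EO _ _ EM] := iE.
exists a; split; first exact: EO.
move=> x; split=> [Ex|[y [Oy ->]]]; last by rewrite mulrC; exact: EM.
exists (x / a); split; last by rewrite mulrC divfK.
split; first by apply: subf_div => //; case: (EO _ Ex).
rewrite mulrC; apply: (@ext_ideal_semilinear L I idfun) (Ex) => // y Iy.
  exact/OK_sub/IO.
by rewrite mulrC; exact: Ia.
Qed.

Lemma ext_generated1 : ext_generated (OK k) 1.
Proof.
split; [exact: subf1 | exact: oner_neq0 | by move=> x [_ Ax]; rewrite divr1 |].
by apply: mem_ideal_gen; exact: OK1.
Qed.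

Lemma ext_generatedM I J a b : (forall x, I x -> OK k x) -> (forall x, J x -> OK k x) ->
  ext_generated I a -> ext_generated J b -> ext_generated (ideal_mul k I J) (a * b).
Proof.
move=> IO JO [La a0 Ia Ea] [Lb b0 Jb Eb].
have iIJ := ideal_mul_ideal kf IO JO; have [IJO _ _ _] := iIJ.
have iE := ext_ideal_ideal IJO.
split; [exact: subfM | by rewrite mulf_neq0 | |].
  move=> x h; suff [] : OK k x /\ x / (a * b) \in Aint by [].
  apply: (@ideal_mul_ind k (fun t => OK k t /\ t / (a * b) \in Aint) _ _ _ _ _ h) => [|y z Iy Jz].
    by apply: ideal_Aint_div => //; exact: ideal_OK.
  split; first by apply: OKM; [exact: kf | exact: IO | exact: JO].
  by rewrite -mulf_div rpredM ?Ia ?Jb.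
rewrite mulrC; apply: (ext_ideal_mulr IO iE _ Ea) => x Ix.
rewrite mulrC; apply: (ext_ideal_mulr JO iE _ Eb) => y Jy.
by apply: mem_ideal_gen; exact: mem_ideal_mul.
Qed.

Lemma ideal_prod_ideal n J : (forall j, (j < n)%N -> ideal k (J j)) -> ideal k (ideal_prod k n J).
Proof.
elim: n => [|n IH] hJ /=; first exact: ideal_OK.
apply: ideal_mul_ideal => //.
  by have [] := IH (fun j jn => hJ j (ltnW jn)).
by have [] := hJ n (ltnSn n).
Qed.

Lemma ext_generated_prod n J : (forall j, (j < n)%N -> ideal k (J j)) ->
    (forall j, (j < n)%N -> exists a, ext_generated (J j) a) ->
  exists a, ext_generated (ideal_prod k n J) a.
Proof.
elim: n => [|n IH] iJ hJ /=; first by exists 1; exact: ext_generated1.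
have [a ha] := IH (fun j jn => iJ j (ltnW jn)) (fun j jn => hJ j (ltnW jn)).
have [b hb] := hJ n (ltnSn n).
exists (a * b); apply: ext_generatedM => //; last by have [] := iJ n (ltnSn n).
by have [] := ideal_prod_ideal (fun j (jn : (j < n)%N) => iJ j (ltnW jn)).
Qed.

(** Cancels P' without inverting it: x in I is tested against a', which lies in P' O_L, so that only
    products in I P' occur; conversely a lies in P O_L, and y0 P = x0 I P'. *)
Lemma ext_generated_same_class I P' P a' a : ideal k I -> ideal k P' -> ideal k P ->
    ext_generated P' a' -> ext_generated P a ->
    same_class k (ideal_mul k I P') P ->
  exists c, ext_generated I c.
Proof.
move=> iI iP' iP [La' a'0 Pa' Ea'] [La a0 Pa Ea] [x0 [y0 [[kx0 _] [ky0 _] x00 y00 h]]].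
have [IO _ _ _] := iI; have [P'O _ _ _] := iP'; have [PO _ _ _] := iP.
have Lx0 := kL kx0; have Ly0 := kL ky0.
exists (y0 * a / (x0 * a')); split.
- by apply: subf_div; rewrite //; apply: subfM.
- by rewrite !mulf_neq0 ?invr_eq0 ?mulf_neq0.
- move=> x Ix.
  have -> : x / (y0 * a / (x0 * a')) = x0 * x / (y0 * a) * a'.
    by field; rewrite ?x00 ?y00 ?a0 ?a'0.
  apply: (@ext_ideal_semilinear L P' idfun) (Ea') => // [y /P'O/OK_sub //|y P'y /=].
  have [|z [Pz zE]] := (h (x0 * (x * y))).1.
    by exists (x * y); split=> //; exact: mem_ideal_mul.
  have -> : x0 * x / (y0 * a) * y = (x0 * (x * y)) / (y0 * a) by ring.
  by rewrite zE invfM mulrACA divff // mul1r; exact: Pa.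
have iE := ext_ideal_ideal IO; have [EO E0 ED EM] := iE.
have -> : y0 * a / (x0 * a') = y0 / (x0 * a') * a by ring.
apply: (ext_ideal_mulr PO iE _ Ea) => z Pz.
have [|y [hy yE]] := (h (y0 * z)).2; first by exists z.
have -> : y0 / (x0 * a') * z = y / a'.
  have -> : y0 / (x0 * a') * z = y0 * z / (x0 * a') by ring.
  by rewrite yE invfM mulrACA divff // mul1r.
suff [] : OK k y /\ ext_ideal L I (y / a') by [].
apply: (@ideal_mul_ind k (fun t => OK k t /\ ext_ideal L I (t / a')) _ _ _ _ _ hy) => [|b c Ib P'c].
  split=> [t []//||t t' [Ot Et] [Ot' Et']|t t' Ot [Ot' Et]].
  - by split; [exact: (OK0 kf) | rewrite mul0r].
  - by split; [exact: (OKD kf) | rewrite mulrDl; exact: ED].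
  - by split; [exact: (OKM kf) | rewrite -mulrA; apply: EM => //; exact: OK_sub].
split; first by apply: (OKM kf); [exact: IO | exact: P'O].
have -> : b * c / a' = (c / a') * b by ring.
apply: EM; last exact: mem_ideal_gen.
by split; [apply: subf_div => //; case: (OK_sub (P'O _ P'c)) | exact: Pa'].
Qed.

End Extension.

Section InvariantIdeals.

Variables (p1 p2 : nat) (sigma : {rmorphism algC -> algC}).
Let d := (2 * p1 * p2)%N.
Let r := sqrtn d.
Let k := gen_field [:: r; 'i].
Variable L : algC -> Prop.
Hypotheses (pp1 : prime p1) (pp2 : prime p2) (p14 : (p1 %% 4 = 1)%N) (p24 : (p2 %% 4 = 1)%N).
Hypotheses (Lf : Defs.subfield_closed L) (Li : L 'i).
Hypotheses (L2 : L (sqrtn 2)) (L1 : L (sqrtn p1)) (L2' : L (sqrtn p2)).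
Hypotheses (sigma_i : sigma 'i = 'i) (sigma_r : sigma r = - r).

Lemma L_r : L r.
Proof. by rewrite /r /d !sqrtnM; apply: subfM => //; exact: subfM. Qed.

Lemma k_sub_L x : k x -> L x.
Proof. by apply=> // y; rewrite !inE => /orP[] /eqP -> //; exact: L_r. Qed.

Let r2 : gen_field [:: 'i] (r ^+ 2). Proof. exact: sqrtn_sqr_gen. Qed.

(* If (g) is the trace ideal of J over Z[i], then g lies in J by invariance and
   J lies in (g / 2d); hence J^2 = (n) with g^2 = n s and s dividing 4 d^2. *)
Lemma invariant_ext_generated J : nz_ideal k J -> sigma_invariant d%:R J ->
  exists a, ext_generated L J a.
Proof.
move=> nzJ sJ; have [iJ [x0 [Jx0 x00]]] := nzJ; have [JO J0 JD JM] := iJ.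
have Js x : J x -> J (sigma x) by apply: sJ.
have d0 : d%:R != 0 :> algC.
  by rewrite pnatr_eq0 -lt0n !muln_gt0 !prime_gt0.
have r0 : r != 0 by rewrite -sqrf_eq0 sqrtn_sqr.
have rr : r * r = d%:R by rewrite -expr2 sqrtn_sqr.
have r2A : r ^+ 2 \in Aint by exact: sqrtn_sqr_Aint.
have Or : OK k r by exact: OK_quad_r.
have [n [zn n0 nJ nA]] := ideal_norm_generator r2 sigma_i sigma_r nzJ.
have {}nJ : ideal_mul k J J n.
  move=> M iM MJ; apply: nJ => // _ [a [_ [Ja [b [Jb ->]] ->]]].
  by apply: MJ; exists a, (sigma b); split=> //; exact: Js.
have {}nA x y : J x -> J y -> x * y / n \in Aint.
  move=> Jx Jy; have -> : y = sigma (sigma y) by rewrite (sigmaK_quad r2) //; case: (JO _ Jy).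
  by apply: nA => //; exact: Js.
pose P z := exists x, J x /\ z = x + sigma x.
have two : 2 != 0 :> algC by rewrite pnatr_eq0.
have [||||g [[x1 [Jx1 gE]] g0 gP]] := @Zi_principal P.
- by move=> _ [x [Jx ->]]; apply: (Zi_quad_trace r2) => //; exact: JO.
- move=> _ _ [x [Jx ->]] [y [Jy ->]]; exists (x + y); split; first exact: JD.
  by rewrite rmorphD; ring.
- move=> a _ za [x [Jx ->]]; exists (a * x); split; first by apply: JM => //; exact: OK_Zi.
  by rewrite rmorphM (sigma_Zi sigma_i za); ring.
- have [t0|t0] := eqVneq (x0 + sigma x0) 0; last by exists (x0 + sigma x0); split=> //; exists x0.
  (* If x0 has trace 0, then r x0 is fixed by sigma and has trace 2 r x0. *)
  exists (r * x0 + sigma (r * x0)); split; first by exists (r * x0); split=> //; exact: JM.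
  rewrite rmorphM sigma_r; have -> : sigma x0 = - x0 by apply/eqP; rewrite -addr_eq0 addrC t0.
  by rewrite mulrNN -mulr2n -mulr_natl !mulf_neq0.
have Jg : J g by rewrite gE; apply: JD => //; exact: Js.
(* Since sigma(r) = -r and r^2 = d, 2 d x = d Tr(x) + r Tr(r x), and g divides both traces. *)
have gA x : J x -> 2 * d%:R * x / g \in Aint.
  move=> Jx.
  have [|a [za aE]] := gP (x + sigma x); first by exists x.
  have [|b [zb bE]] := gP (r * x + sigma (r * x)).
    by exists (r * x); split=> //; exact: JM.
  have -> : 2 * d%:R * x / g = a * d%:R + b * r.
    have -> : a = (x + sigma x) / g by rewrite aE mulfK.
    have -> : b = (r * x - r * sigma x) / g by rewrite -mulNr -sigma_r -rmorphM bE mulfK.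
    by rewrite -rr; field; rewrite ?g0.
  by rewrite rpredD //; apply: rpredM; rewrite ?rpred_nat ?Aint_sqrtn // Zi_Aint.
have Zg : Zi g.
  by rewrite gE; apply: (Zi_quad_trace r2) => //; exact: JO.
have Qg := Zi_gen_field Zg; have Qn := Zi_gen_field zn.
have Qd : gen_field [:: 'i] (4 * d%:R ^+ 2).
  by apply: (subfM gfc); [exact: (subf_nat gfc)|apply: (subfX gfc); exact: (subf_nat gfc)].
have Zs : Zi (g ^+ 2 / n).
  apply: Zi_Qi_Aint; last by rewrite expr2; exact: nA.
  by apply: (subf_div gfc) => //; exact: (subfX gfc).
have Zs' : Zi (n / (g ^+ 2 / (4 * d%:R ^+ 2))).
  apply: Zi_Qi_Aint.
    apply: (subf_div gfc) => //; apply: (subf_div gfc) => //; exact: (subfX gfc).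
  suff [] : OK k n /\ n / (g ^+ 2 / (4 * d%:R ^+ 2)) \in Aint by [].
  apply: (@ideal_mul_ind k (fun t => OK k t /\ t / (g ^+ 2 / (4 * d%:R ^+ 2)) \in Aint)
    _ _ _ _ _ nJ) => [|x y Jx Jy].
    by apply: ideal_Aint_div => //; exact: (ideal_OK gfc).
  split; first by apply: (OKM gfc); exact: JO.
  have -> : x * y / (g ^+ 2 / (4 * d%:R ^+ 2)) = (2 * d%:R * x / g) * (2 * d%:R * y / g).
    by field; rewrite ?d0 ?g0.
  by rewrite rpredM // gA.
have sE : (g ^+ 2 / n) * (n / (g ^+ 2 / (4 * d%:R ^+ 2))) = 4 * d%:R ^+ 2.
  by field; rewrite ?d0 ?g0 ?n0.
have [u [b [[Lu Au Aiu] [Lb b0 u0 gn]]]] := unit_sqr_dvd Lf Li pp1 pp2 p14 p24 L2 L1 L2' Zs Zs' sE.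
pose a := g / b.
have Lg : L g by exact: Zi_sub.
have La : L a by exact: subf_div.
have a0 : a != 0 by rewrite mulf_neq0 ?invr_eq0.
(* So a^2 generates the extension of J^2, and the integrality of x / a can be read off its square
   x^2 / (n u). *)
have a2 : a ^+ 2 = n * u.
  have -> : a ^+ 2 = g ^+ 2 / n * n / b ^+ 2 by rewrite /a; field; rewrite ?n0 ?b0.
  by rewrite gn; field; rewrite ?b0.
have Ja x : J x -> x / a \in Aint.
  move=> Jx; apply: Aint_sqrt; have -> : (x / a) ^+ 2 = (x * x / n) * u^-1.
    by rewrite expr_div_n a2; field; rewrite ?n0 ?u0.
  by rewrite rpredM // nA.
exists a; split=> //.
have iE := ext_ideal_ideal Lf k_sub_L JO; have [EO E0 ED EM] := iE.
have -> : a = u * n / a.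
  by apply: (mulIf a0); rewrite divfK // -expr2 a2 mulrC.
suff [] : OK k n /\ ext_ideal L J (u * n / a) by [].
apply: (@ideal_mul_ind k (fun t => OK k t /\ ext_ideal L J (u * t / a)) _ _ _ _ _ nJ) => [|x y Jx Jy].
  split=> [t []//||t t' [Ot Et] [Ot' Et']|t t' Ot [Ot' Et]].
  - by split; [exact: (OK0 gfc) | rewrite mulr0 mul0r].
  - by split; [exact: (OKD gfc) | rewrite mulrDr mulrDl; exact: ED].
  - split; first exact: (OKM gfc).
    by rewrite mulrCA -mulrA; apply: EM => //; exact: (OK_sub k_sub_L).
split; first by apply: (OKM gfc); exact: JO.
have -> : u * (x * y) / a = (u * (x / a)) * y by ring.
apply: EM; last exact: mem_ideal_gen.
split; first by apply: subfM => //; apply: subf_div => //; apply: k_sub_L; case: (JO _ Jx).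
by rewrite rpredM // Ja.
Qed.

Lemma in_Ams_capitulates I : nz_ideal k I -> in_Ams d%:R k I -> in_capitulation_kernel L I.
Proof.
move=> [iI _] [n [m [J [J' [hJ hJ' cl]]]]].
have iJ j : (j < n)%N -> ideal k (J j) by move=> /hJ[[]].
have iJ' j : (j < m)%N -> ideal k (J' j) by move=> /hJ'[[]].
have [a ha] : exists a, ext_generated L (ideal_prod k n J) a.
  apply: (ext_generated_prod gfc Lf k_sub_L) => // j /hJ[nz sg].
  exact: invariant_ext_generated.
have [a' ha'] : exists a, ext_generated L (ideal_prod k m J') a.
  apply: (ext_generated_prod gfc Lf k_sub_L) => // j /hJ'[nz sg].
  exact: invariant_ext_generated.
have [c hc] := ext_generated_same_class gfc Lf k_sub_L iI (ideal_prod_ideal gfc iJ')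
  (ideal_prod_ideal gfc iJ) ha' ha cl.
by apply: (ext_generated_principal Lf k_sub_L _ hc); case: iI.
Qed.

End InvariantIdeals.

(** * Automorphisms of k and K, and the three choices of K *)

Lemma exists_quad_aut a b p p' : (0 < a)%N -> odd (logn p b) -> odd (logn p' (a * b)) ->
  exists u : {rmorphism algC -> algC},
    [/\ u 'i = 'i, u (sqrtn a) = sqrtn a & u (sqrtn b) = - sqrtn b].
Proof.
move=> a0 ob oab.
have [|b2|u [us ub]] := @exists_sqrt_aut [:: sqrtn a; 'i] (sqrtn b).
- exact: sqrtn_sqr_gen.
- by have [[m]|[m]] := sqrtn_Qi_sqrtn a0 b2;
    [exact: odd_logn_not_square ob | exact: odd_logn_not_square oab].
by exists u; split=> //; apply: us; rewrite !inE eqxx ?orbT.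
Qed.

(** Valuations at 2 show that d and q d are not squares, the valuation at p that q is not; hence the
    signs of sqrt d and sqrt q can be changed independently over Q(i). *)
Lemma capitulation_in_Ams_sqrt d q p K I : (0 < d)%N -> (q %% 4 = 1)%N -> (4 < p)%N ->
    odd (logn p q) -> odd (logn 2 d) ->
    (forall x, K x <-> gen_field [:: sqrtn d; sqrtn q; 'i] x) ->
    nz_ideal (gen_field [:: sqrtn d; 'i]) I -> in_capitulation_kernel K I ->
  in_Ams d%:R (gen_field [:: sqrtn d; 'i]) I.
Proof.
move=> d0 q4 p4 op o2 KE nzI KI.
have q0 : (0 < q)%N by case: (q) q4.
have q2 : logn 2 q = 0%N.
  apply/eqP; rewrite -leqn0 leqNgt logn_gt0 mem_primes /= q0 /= dvdn2 negbK.
  by move: q4; clear; lia.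
have o2q : odd (logn 2 (q * d)) by rewrite lognM // q2.
have [sg [sg_i sg_q sg_d]] := exists_quad_aut q0 o2 o2q.
rewrite mulnC in o2q.
have [tau [tau_i tau_d tau_q]] := exists_quad_aut d0 op o2q.
apply: (capitulation_in_Ams q4 p4 op _ KE sg_i sg_q sg_d tau_i tau_d tau_q) KI => //.
  by have h := gen_field_closed [:: sqrtn d; sqrtn q; 'i]; split; rewrite ?KE;
    [exact: subf0 | exact: subf1 | move=> x y; rewrite !KE; exact: subfB
    | move=> x y; rewrite !KE; exact: subfM | move=> x; rewrite !KE; exact: subfV].
by rewrite -sqrf_eq0 sqrtn_sqr pnatr_eq0 -lt0n.
Qed.

Theorem mainTheorem1 (p1 p2 : nat) :
  prime p1 -> prime p2 -> p1 != p2 ->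
  (p1 %% 4 = 1)%N -> (p2 %% 4 = 1)%N ->
  let k := gen_field [:: sqrtn (2 * p1 * p2)%N; 'i] in
  let kstar := gen_field [:: sqrtn 2%N; sqrtn p1; sqrtn p2; 'i] in
  forall K : algC -> Prop,
    (K = gen_field [:: sqrtn (2 * p1 * p2)%N; 'i; sqrtn p1] \/
     K = gen_field [:: sqrtn (2 * p1 * p2)%N; 'i; sqrtn p2] \/
     K = gen_field [:: sqrtn (2 * p1 * p2)%N; 'i; sqrtn 2%N]) ->
    (forall I, nz_ideal k I -> in_capitulation_kernel K I ->
       in_Ams (2 * p1 * p2)%N%:R k I) /\
    (forall I, nz_ideal k I -> in_Ams (2 * p1 * p2)%N%:R k I ->
       in_capitulation_kernel kstar I).
Proof.
move=> pp1 pp2 p12 p14 p24 k kstar K hK; set d := (2 * p1 * p2)%N.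
have gt4 p : prime p -> (p %% 4 = 1)%N -> (4 < p)%N.
  by case: p => [|[|[|[|[|p]]]]].
have p1_gt0 := prime_gt0 pp1; have p2_gt0 := prime_gt0 pp2.
have d0 : (0 < d)%N by rewrite !muln_gt0 p1_gt0 p2_gt0.
have o2 : odd (logn 2 d).
  rewrite /d !lognM ?muln_gt0 ?p1_gt0 // !logn_prime //=.
  by case: eqP => [e|_]; [rewrite -e in p14|case: eqP => [e|_] //; rewrite -e in p24].
have o1 : odd (logn p1 p1) by rewrite logn_prime // eqxx.
have op2 : odd (logn p2 p2) by rewrite logn_prime // eqxx.
split=> I nzI.
  case: hK => [->|[->|->]].
  - apply: (@capitulation_in_Ams_sqrt d p1 p1) => // [|x]; first exact: gt4.
    by split; apply: gen_field_mono => y; rewrite !inE => /or3P[] ->; rewrite ?orbT.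
  - apply: (@capitulation_in_Ams_sqrt d p2 p2) => // [|x]; first exact: gt4.
    by split; apply: gen_field_mono => y; rewrite !inE => /or3P[] ->; rewrite ?orbT.
  (* k(sqrt 2) is k(sqrt (p1 p2)), and p1 p2 = 1 mod 4, whereas 2 is not. *)
  - have dE : sqrtn d = sqrtn 2 * sqrtn (p1 * p2) by rewrite -sqrtnM mulnA.
    have nz n : (0 < n)%N -> sqrtn n != 0 by rewrite -sqrf_eq0 sqrtn_sqr pnatr_eq0 lt0n.
    have gm s y : y \in s -> gen_field s y by exact: gen_field_mem.
    apply: (@capitulation_in_Ams_sqrt d (p1 * p2) p1) => // [|||x].
    + by rewrite -modnMm p14 p24.
    + exact: gt4.
    + by rewrite lognM // !logn_prime // eqxx (negPf p12).
    split; apply: gen_field_sub => y; rewrite !inE => /or3P[] /eqP ->;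
      try (by apply: gm; rewrite !inE eqxx ?orbT).
    + have -> : sqrtn 2 = sqrtn d / sqrtn (p1 * p2).
        by rewrite dE mulfK // nz // muln_gt0 p1_gt0.
      by apply: (subf_div gfc); apply: gm; rewrite !inE eqxx ?orbT.
    have -> : sqrtn (p1 * p2) = sqrtn d / sqrtn 2 by rewrite dE mulrC mulKf // nz.
    by apply: (subf_div gfc); apply: gm; rewrite !inE eqxx ?orbT.
(* Taking a = 1 asks only for the sign change of sqrt d. Invariance in [in_Ams] is quantified over
   all such automorphisms, so one of them is enough to exploit it. *)
have o2' : odd (logn 2 (1 * d)) by rewrite mul1n.
have [sg [sg_i _ sg_d]] := exists_quad_aut (ltn0Sn 0) o2 o2'.
have mem y : y \in [:: sqrtn 2; sqrtn p1; sqrtn p2; 'i] -> kstar y by exact: gen_field_mem.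
apply: (in_Ams_capitulates (L := kstar) pp1 pp2 p14 p24 gfc _ _ _ _ sg_i sg_d nzI);
  by apply: mem; rewrite !inE eqxx ?orbT.
Qed.
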